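(* Let $d,b,k,n\in\{1,2,3,\ldots\}$ and $0<\delta\le 1$. There exists an estimator $V_n\in\mathcal{D}_d$ (a function of the sample $X_1,\ldots,X_n$, not depending on the sampling density or on the sequences $W,L$ below) such that, for any NL-class $\mathfrak{V}(W,L)$ and any density $p\in\mathcal{D}_d\cap\mathfrak{V}(W,L)$, if $X_1,\ldots,X_n$ are i.i.d. with density $p$, then $$P\left(\|p-V_n\|_1>\frac{\sqrt{3}\,d}{2b}L_k+6W_k+7\sqrt{\frac{2bdk\log(4bdkn)}{n}}+7\sqrt{\frac{\log(3/\delta)}{2n}}\right)<\delta .$$
   Context: A pdf on $\mathbb{R}^d$ is an a.e. non-negative function on $\mathbb{R}^d$ with Lebesgue integral equal to one; equalities of functions mean equality Lebesgue-a.e. $\mathcal{D}_d$ is the set of all pdfs whose support is contained in the unit cube $[0,1]^d$. $\|\cdot\|_1$ is the $L^1$ norm with respect to Lebesgue measure. An estimator in $\mathcal{D}_d$ is a (measurable) map from samples $(X_1,\ldots,X_n)$ to $\mathcal{D}_d$. For functions $f_1,\ldots,f_d:\mathbb{R}\to\mathbb{R}$, $\prod_{j=1}^d f_j$ denotes $(x_1,\ldots,x_d)\mapsto f_1(x_1)\cdots f_d(x_d)$. Definition (NL-spectrum). A pdf $p$ on $\mathbb{R}^d$ has a non-negative Lipschitz spectrum (NL-spectrum) $(w,\ell)$, with $w=(w_i)_{i=1}^\infty$ and $\ell=(\ell_i)_{i=1}^\infty$, if $$p=\sum_{i=1}^\infty w_i\prod_{j=1}^d p_{i,j},$$ where $(w_i)_{i=1}^\infty$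 is a non-negative sequence with $\sum_{i=1}^\infty w_i=1$ and $w_1>0$, and the $p_{i,j}$ ($i\ge1$, $1\le j\le d$) are Lipschitz continuous pdfs on $\mathbb{R}$ with Lipschitz constant $\ell_i$, i.e. $|p_{i,j}(x)-p_{i,j}(y)|\le \ell_i|x-y|$ for all $x,y\in\mathbb{R}$. Definition (NL-class). Let $W=(W_i)_{i=1}^\infty$ be a non-negative, non-increasing sequence converging to $0$ and let $L=(L_i)_{i=1}^\infty$ be a non-negative, non-decreasing sequence. The NL-class $\mathfrak{V}(W,L)$ is the set of all pdfs having an NL-spectrum $(w,\ell)$ that satisfies $\ell_k\le L_k$ and $\sum_{i=k+1}^\infty w_i\le W_k$ for all $k\ge 1$. *)

(* Defs.v *)
From HB Require Import structures.
From mathcomp Require Import all_boot all_order all_algebra.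
From mathcomp Require Import all_classical all_reals all_analysis.

Set Implicit Arguments.
Unset Strict Implicit.
Unset Printing Implicit Defensive.

Import Order.TTheory GRing.Theory Num.Theory.
Import numFieldNormedType.Exports.

Local Open Scope classical_set_scope.
Local Open Scope ring_scope.

Section tcons.
Context {dd} {T : measurableType dd} (n : nat).

Definition tcons (z : T * n.-tuple T) : n.+1.-tuple T := [tuple of z.1 :: z.2].

Lemma measurable_tcons : measurable_fun setT tcons.
Proof.
by apply: measurable_cons; [exact: measurable_fst|exact: measurable_snd].
Qed.

HB.instance Definition _ :=
  isMeasurableFun.Build _ _ _ _ tcons measurable_tcons.

End tcons.

Section consm.
Context {dd} {T : measurableType dd} {R : realType} (n : nat).
Variables (m1 : {sigma_finite_measure set T -> \bar R})
  (m2 : {sigma_finite_measure set (n.-tuple T) -> \bar R}).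

Definition tcons_measure : set (n.+1.-tuple T) -> \bar R :=
  pushforward (m1 \x m2)%E (@tcons dd T n).

Let tcons_measure0 : tcons_measure set0 = 0%E.
Proof. by rewrite /tcons_measure /pushforward preimage_set0 measure0. Qed.

Let tcons_measure_ge0 A : (0 <= tcons_measure A)%E.
Proof. exact: measure_ge0. Qed.

Let tcons_measure_sigma_additive : semi_sigma_additive tcons_measure.
Proof.
move=> F mF tF mUF; rewrite /tcons_measure /pushforward preimage_bigcup.
apply: measure_semi_sigma_additive.
- by move=> i; rewrite -[X in measurable X]setTI; exact: measurable_tcons.
- apply/trivIsetP => i j _ _ ij; rewrite -preimage_setI.
  by move/trivIsetP : tF => ->//; rewrite preimage_set0.
- rewrite -preimage_bigcup -[X in measurable X]setTI.
  exact: measurable_tcons.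
Qed.

HB.instance Definition _ := isMeasure.Build _ _ _ tcons_measure
  tcons_measure0 tcons_measure_ge0 tcons_measure_sigma_additive.

Let tcons_measure_sigma_finite : sigma_finite setT tcons_measure.
Proof.
have /sigma_finiteP[F [TF ndF Foo]] := sigma_finiteT m1.
have /sigma_finiteP[G [TG ndG Goo]] := sigma_finiteT m2.
pose g (z : n.+1.-tuple T) := (thead z, [tuple of behead z]).
have mg : measurable_fun setT g.
  apply/measurable_fun_pair; first exact: measurable_tnth.
  exact: measurable_behead.
have gK : cancel (@tcons dd T n) g.
  move=> [x t]; rewrite /g/tcons /= theadE; congr pair.
  exact: val_inj.
exists (fun i => g @^-1` (F i `*` G i)).
  rewrite -preimage_bigcup; apply/seteqP; split=> // z _ /=.
  have [i _ Fi] : (\bigcup_i F i) (g z).1 by rewrite -TF.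
  have [j _ Gj] : (\bigcup_i G i) (g z).2 by rewrite -TG.
  exists (maxn i j) => //; split.
    by move: Fi; exact/subsetPset/ndF/leq_maxl.
  by move: Gj; exact/subsetPset/ndG/leq_maxr.
move=> i; have [mFi Fioo] := Foo i; have [mGi Gioo] := Goo i; split.
  by rewrite -[X in measurable X]setTI; apply: mg => //; exact: measurableX.
rewrite /tcons_measure /pushforward -comp_preimage.
rewrite (_ : g \o _ = id); last by apply/funext => z /=; rewrite gK.
by rewrite preimage_id product_measure1E// lte_mul_pinfty// ge0_fin_numE.
Qed.

HB.instance Definition _ :=
  Measure_isSigmaFinite.Build _ _ _ tcons_measure tcons_measure_sigma_finite.
End consm.

(* R^d, with the product sigma-algebra of the Borel sets of R: the type
   measurableTypeR R, convertible to R, is the domain of lebesgue_measure. *)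
Notation Rvec R d := (d.-tuple (measurableTypeR R)).

Fixpoint lebesgue_tuple {R : realType} (d : nat) :
    {sigma_finite_measure set (Rvec R d) -> \bar R} :=
  match d with
  | 0 => \d_([tuple] : Rvec R 0)
  | d'.+1 => tcons_measure (@lebesgue_measure R) (lebesgue_tuple d')
  end.

Lemma lebesgue_tuple_box {R : realType} (d : nat)
    (A : 'I_d -> set (measurableTypeR R)) :
  (forall i, measurable (A i)) ->
  lebesgue_tuple d [set x | forall i, A i (tnth x i)] =
  (\prod_(i < d) lebesgue_measure (A i))%E.
Proof.
elim: d A => [|d IH] A mA.
  rewrite big_ord0 /= diracE mem_set//= => -[] //.
rewrite big_ord_recl /= /tcons_measure /pushforward.
rewrite -IH; last by move=> i; exact: mA.
rewrite -product_measure1E//; last first.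
  rewrite (_ : mkset _ =
      \bigcap_(i in [set: 'I_d]) (@tnth _ _ ^~ i) @^-1` A (lift ord0 i)).
    apply: fin_bigcap_measurable => // i _.
    by rewrite -[X in measurable X]setTI; exact: measurable_tnth.
  by apply/seteqP; split=> x /= h i *; exact: h.
congr (product_measure1 _ _ _).
apply/seteqP; split=> -[x t] /=.
  move=> h; split; first exact: (h ord0).
  by move=> i; have := h (lift ord0 i); rewrite tnthS.
move=> [h0 h] i; case: (unliftP ord0 i) => [j ->|->].
  by rewrite tnthS.
exact: h0.
Qed.

(* The functions below are representatives of classes modulo almost everywhere
   equality, chosen Borel measurable. *)
Definition is_pdf dd (T : measurableType dd) (R : realType)
    (mu : {measure set T -> \bar R}) (p : T -> R) : Prop :=
  [/\ measurable_fun setT p,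
      {ae mu, forall x, 0 <= p x} &
      (\int[mu]_x (p x)%:E = 1)%E].

Definition unit_cube {R : realType} (d : nat) : set (Rvec R d) :=
  [set x | forall i : 'I_d, 0 <= (tnth x i : R) <= 1].

Arguments unit_cube {R} d.

(* As the cube is closed, the (essential) support of p lies in the cube iff p
   vanishes almost everywhere outside of it. *)
Definition cube_pdf {R : realType} (d : nat) : set (Rvec R d -> R) :=
  [set p | is_pdf (lebesgue_tuple d) p /\
     {ae lebesgue_tuple d, forall x, ~ unit_cube d x -> p x = 0}].

Arguments cube_pdf {R} d.

Definition L1_dist {R : realType} (d : nat) (f g : Rvec R d -> R) : \bar R :=
  'N[lebesgue_tuple d]_1%:E [EFin \o (f \- g)].

Definition L1_open {R : realType} (d : nat) : set (set (Rvec R d -> R)) :=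
  [set U | U `<=` cube_pdf d /\
     forall f, U f -> exists2 e : R, 0 < e &
       forall g, cube_pdf d g -> (L1_dist f g < e%:E)%E -> U g].

Arguments L1_open {R} d.

(* Measurability is with respect to the Borel sigma-algebra of the L^1 metric on
   the set of pdfs supported in the cube. *)
Definition is_estimator {R : realType} (d n : nat)
    (V : n.-tuple (Rvec R d) -> Rvec R d -> R) : Prop :=
  (forall s, cube_pdf d (V s)) /\
  (forall B, <<s cube_pdf d, L1_open d >> B ->
     measurable (V @^-1` B)).

(* Sequences are indexed from 1: their value at 0 is never used. *)
Definition has_NL_spectrum {R : realType} (d : nat) (p : Rvec R d -> R)
    (w l : nat -> R) : Prop :=
  exists q : nat -> 'I_d -> R -> R,
  [/\ (forall i, (1 <= i)%N -> 0 <= w i),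
      (\sum_(1 <= i <oo) (w i)%:E = 1)%E,
      0 < w 1%N,
      (forall i j, (1 <= i)%N ->
         is_pdf lebesgue_measure (q i j) /\ (l i).-lipschitz (q i j)) &
      {ae lebesgue_tuple d, forall x, ((p x)%:E =
         \sum_(1 <= i <oo) (w i * \prod_(j < d) q i j (tnth x j))%:E)%E}].

Definition NL_params {R : realType} (W L : nat -> R) : Prop :=
  [/\ (forall k, (1 <= k)%N -> 0 <= W k),
      (forall j k, (1 <= j <= k)%N -> W k <= W j),
      W @ \oo --> 0,
      (forall k, (1 <= k)%N -> 0 <= L k) &
      (forall j k, (1 <= j <= k)%N -> L j <= L k)].

Definition NL_class {R : realType} (d : nat) (W L : nat -> R) :
    set (Rvec R d -> R) :=
  [set p | is_pdf (lebesgue_tuple d) p /\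
     exists w l : nat -> R, has_NL_spectrum p w l /\
       forall k, (1 <= k)%N ->
         l k <= L k /\ (\sum_(k.+1 <= i <oo) (w i)%:E <= (W k)%:E)%E].

Arguments NL_class {R} d W L.

Definition has_density dd (Omega : measurableType dd) (R : realType)
    (P : probability Omega R) (d : nat) (X : {RV P >-> Rvec R d})
    (p : Rvec R d -> R) : Prop :=
  forall A, measurable A ->
    distribution P X A = (\int[lebesgue_tuple d]_(x in A) (p x)%:E)%E.

Definition independent_RVs dd dd' (Omega : measurableType dd)
    (T : measurableType dd') (R : realType) (P : probability Omega R) (n : nat)
    (X : 'I_n -> {RV P >-> T}) : Prop :=
  forall A : 'I_n -> set T, (forall i, measurable (A i)) ->
    P [set om | forall i, A i (X i om)] = (\prod_(i < n) P (X i @^-1` A i))%E.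

(* Main.v *)
(* The estimator is the minimum distance (Yatracos) selection over a finite net
   of multi-view histograms: mixtures of at most k products of one-dimensional
   histograms with b bins, all weights having denominator M = 4bdkn - 1. There
   are at most (4bdkn)^(bdk) such densities.

   Bias: keep the k first components of the spectrum and replace each Lipschitz
   factor, which lives on the unit interval because p lives on the cube, by its
   bin averages; a bin of width h costs l h^2 / sqrt 12. The dropped weights are
   paid twice, once as missing mass and once when the weights are completed to a
   probability vector, and rounding to the net costs O(1/n).

   Variance: with t the largest deviation of the empirical measure on the
   Scheffe sets of the net, the selected density is within 3 (bias) + 4 t of p.
   A union bound over the pairs of the net needs only the tail 2 exp(-n t^2),
   for which symmetrisation and cosh x <= exp(x^2 / 2) suffice; the sharp
   constant in Hoeffding's inequality is not needed. *)
Require Import Defs.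
From mathcomp Require Import all_boot all_order all_algebra.
From mathcomp Require Import all_classical all_reals all_analysis.
From mathcomp Require Import measurable_realfun.
From mathcomp Require Import zify ring lra.

Set Implicit Arguments.
Unset Strict Implicit.
Unset Printing Implicit Defensive.

Import Order.TTheory GRing.Theory Num.Theory.
Import numFieldNormedType.Exports.

Local Open Scope classical_set_scope.
Local Open Scope ring_scope.

(** * Tail bound for independent indicators *)

(** The difference of the two sides vanishes at 0 and has derivative [y * (expR y - expR (- y))],
    which is non-negative for [y >= 0]. *)
Lemma coshR_sinhR_le {R : realType} (x : R) : 0 <= x ->
  expR x - expR (- x) <= x * (expR x + expR (- x)).
Proof.
move=> x0; pose f := fun y : R => y * (expR y + expR (- y)) - (expR y - expR (- y)).
have df y : is_derive y (1 : R) f (y * (expR y - expR (- y))).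
  by apply: is_derive_eq; rewrite /GRing.scale /=; ring.
have cf : {within `[0, x], continuous f}.
  by apply: derivable_within_continuous => y _; exact: (@ex_derive _ _ _ _ _ _ _ (df y)).
have [c cx] := MVT_segment x0 (fun y _ => df y) cf.
rewrite /f /= oppr0 !expR0 mul0r subrr !subr0 addr0 => fx.
rewrite -subr_ge0 fx.
have c0 : 0 <= c by rewrite (itvP cx).
apply: mulr_ge0 => //; apply: mulr_ge0 => //.
by rewrite subr_ge0 ler_expR ge0_cp.
Qed.

(** By the previous inequality, [cosh y * exp (- y^2 / 2)] does not increase on [y >= 0]; the claim
    is even in [x]. *)
Lemma coshR_le_expR_sqr {R : realType} (x : R) :
  expR x + expR (- x) <= 2 * expR (x ^+ 2 / 2).
Proof.
wlog x0 : x / 0 <= x.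
  have [x0|/ltW x0] := leP 0 x; first exact.
  by move=> /(_ (- x)); rewrite opprK sqrrN addrC oppr_ge0; exact.
pose f := fun y : R => (expR y + expR (- y)) * expR (- (y ^+ 2 / 2)).
pose df (y : R) : R := expR (- (y ^+ 2 / 2)) *
  (expR y - expR (- y) - y * (expR y + expR (- y))).
have dfP y : is_derive y (1 : R) f (df y).
  by apply: is_derive_eq; rewrite /df /GRing.scale /=; field.
have cf : {within `[0, x], continuous f}.
  by apply: derivable_within_continuous => y _; exact: (@ex_derive _ _ _ _ _ _ _ (dfP y)).
have [c cx] := MVT_segment x0 (fun y _ => dfP y) cf.
rewrite /f /= oppr0 !expR0 expr0n /= mul0r oppr0 expR0 mulr1 addr0 => fx.
have : df c * x <= 0.
  rewrite mulr_le0_ge0// /df mulr_ge0_le0 ?expR_ge0// subr_le0.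
  by rewrite coshR_sinhR_le// (itvP cx).
by rewrite -fx subr_le0 (expRN (x ^+ 2 / 2)) ler_pdivrMr ?expR_gt0.
Qed.

(* [e^{-lp}] is at most the moment generating function of an independent copy
   at [-l], by convexity; the product of the two is [1 + 2p(1-p)(cosh l - 1)]. *)
Lemma bernoulli_mgf_le {R : realType} (p l : R) : 0 <= p <= 1 ->
  (p * expR l + (1 - p)) * expR (- (l * p)) <= expR (l ^+ 2 / 4).
Proof.
move=> /andP[p0 p1].
have cvx : expR (- (l * p)) <= p * expR (- l) + (1 - p).
  have p01 : 0 <= 1 - p <= 1 by rewrite subr_ge0 p1 gerBl.
  have := @convex_expR R (Itv01 (proj1 (andP p01)) (proj2 (andP p01))) 0 (- l).
  rewrite !convRE /= expR0 /unstable.onem.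
  rewrite mulr0 add0r mulr1 (_ : 1 - (1 - p) = p); last by ring.
  by rewrite mulrN (mulrC p l) addrC.
have q0 : 0 <= 1 - p by rewrite subr_ge0.
have e0 : 0 <= p * expR l + (1 - p) by rewrite addr_ge0// mulr_ge0// expR_ge0.
apply: (le_trans (ler_wpM2l e0 cvx)).
have ee : expR l * expR (- l) = 1 by rewrite expRxMexpNx_1.
have -> : (p * expR l + (1 - p)) * (p * expR (- l) + (1 - p)) =
  1 + p * (1 - p) * (expR l + expR (- l) - 2).
  transitivity (p * p * (expR l * expR (- l)) + p * (1 - p) * (expR l + expR (- l))
    + (1 - p) * (1 - p)); first by ring.
  by rewrite ee; ring.
have eh (y : R) : expR y = expR (y / 2) ^+ 2.
  by rewrite -expRM_natl; congr expR; field.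
have hh := coshR_le_expR_sqr (l / 2).
have hh0 : 0 <= expR (l / 2) + expR (- l / 2) by rewrite addr_ge0// expR_ge0.
(* Squaring the bound at [l / 2] makes the left side [e^l + e^(-l) + 2]. With [p (1 - p) <= 1 / 4],
   four times the product to be bounded is at most this quantity. *)
have : (expR (l / 2) + expR (- l / 2)) ^+ 2 <= 4 * expR (l ^+ 2 / 4).
  rewrite mulNr (_ : 4 * _ = (2 * expR ((l / 2) ^+ 2 / 2)) ^+ 2); last first.
    rewrite exprMn -(expRM_natl 2); congr (_ * _); first by ring.
    by congr expR; field.
  by rewrite ler_pXn2r// nnegrE ?mulr_ge0 ?addr_ge0 ?expR_ge0.
have ee2 : expR (l / 2) * expR (- l / 2) = 1 by rewrite mulNr expRxMexpNx_1.
rewrite sqrrD ee2 -!eh /= => h4.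
have : 0 <= (expR (l / 2) - expR (- l / 2)) ^+ 2 by rewrite sqr_ge0.
rewrite sqrrB ee2 -!eh /= => h5.
have pq : p * (1 - p) <= 1 / 4 by have := sqr_ge0 (p - 1 / 2); nra.
have E2 : 0 <= expR l + expR (- l) - 2.
  by lra.
by have := ler_wpM2r E2 pq; lra.
Qed.

Section independent_indicators.
Context d d' (Omega : measurableType d) (T : measurableType d') (R : realType).
Context (P : probability Omega R) (n : nat) (X : 'I_n -> {RV P >-> T}).
Hypothesis indepX : independent_RVs X.
Implicit Types (A : set T) (p t : R).

(** Recording only which observations fall in [A] gives a map with finitely many values.
    Probabilities of events about counts become finite sums, and the Chernoff argument runs without
    integrals. *)
Let pattern A (om : Omega) : {ffun 'I_n -> bool} := [ffun i => X i om \in A].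

Let patternE A e : [set om | pattern A om = e] =
  [set om | forall i, (if e i then A else ~` A) (X i om)].
Proof.
apply/seteqP; split=> om /=.
  by move=> <- i; rewrite ffunE; case: ifPn; rewrite ?inE// notin_setE.
move=> h; apply/ffunP => i; rewrite ffunE; have := h i.
by case: (e i) => ?; [rewrite mem_set|rewrite memNset].
Qed.

Let measurable_if A (b : bool) : measurable A -> measurable (if b then A else ~` A).
Proof. by move=> mA; case: b => //; exact: measurableC. Qed.

Let measurable_pattern A e : measurable A ->
  measurable [set om | pattern A om = e].
Proof.
move=> mA; rewrite patternE (_ : mkset _ =
    \bigcap_(i in [set: 'I_n]) X i @^-1` (if e i then A else ~` A)).
  apply: fin_bigcap_measurable => // i _.
  by apply: measurable_funPTI => //; exact: measurable_if.
by apply/seteqP; split=> om /= h i *; exact: h.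
Qed.

Let pattern_prob A p e : measurable A -> (forall i, P (X i @^-1` A) = p%:E) ->
  P [set om | pattern A om = e] = (\prod_(i < n) (if e i then p else 1 - p))%:E.
Proof.
move=> mA PA; rewrite patternE.
rewrite (indepX (fun i => measurable_if (e i) mA)).
rewrite -prodEFin; apply: eq_bigr => i _; case: (e i) => //.
rewrite -[X i @^-1` ~` A]/(~` (X i @^-1` A)) probability_setC ?PA//.
by apply: measurable_funPTI.
Qed.

Let pattern_pred_prob A p (Q : pred {ffun 'I_n -> bool}) : measurable A ->
  (forall i, P (X i @^-1` A) = p%:E) ->
  measurable [set om | Q (pattern A om)] /\ P [set om | Q (pattern A om)] =
  (\sum_(e | Q e) \prod_(i < n) (if e i then p else 1 - p))%:E.
Proof.
move=> mA PA.
have -> : [set om | Q (pattern A om)] =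
    \bigcup_(e in [set` Q]) [set om | pattern A om = e].
  by apply/seteqP; split=> om /= => [?|[e ? ->]//]; exists (pattern A om).
split; first by apply: fin_bigcup_measurable => // e _; exact: measurable_pattern.
rewrite measure_fin_bigcup//; last 2 first.
- by apply/trivIsetP => e e' _ _ ee'; rewrite -subset0 => om /= [e1 e2];
    move: ee'; rewrite -e1 -e2 eqxx.
- by move=> e _; exact: measurable_pattern.
rewrite -(bigfs _ (r := index_enum _)) ?index_enum_uniq//; last first.
  by move=> e _; rewrite mem_index_enum.
by rewrite -sumEFin; apply: eq_bigr => e _; exact: pattern_prob.
Qed.

(** Chernoff's method with [l = 2 t], the minimiser of [l^2 / 4 - l t], whose minimum is [- t^2]. *)
Let tail A p t : measurable A -> (forall i, P (X i @^-1` A) = p%:E) ->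
  0 <= p <= 1 -> 0 <= t ->
  let S := [set om | n%:R * (p + t) < \sum_(i < n) \1_A (X i om)] in
  measurable S /\ (P S <= (expR (- (n%:R * t ^+ 2)))%:E)%E.
Proof.
move=> mA PA p01 t0 S.
pose Q (e : {ffun 'I_n -> bool}) := n%:R * (p + t) < \sum_(i < n) (e i)%:R.
have SE : S = [set om | Q (pattern A om)].
  apply/seteqP; split=> om; rewrite /S /Q /=;
  under [X in _ < X -> _]eq_bigr do rewrite ?ffunE ?indicE;
  by under [X in _ -> _ < X]eq_bigr do rewrite ?ffunE ?indicE.
have [mS PS] := pattern_pred_prob Q mA PA.
rewrite SE; split; [exact: mS|rewrite PS lee_fin].
have /andP[p0 p1] := p01; have q0 : 0 <= 1 - p by rewrite subr_ge0.
have pr0 (e : {ffun 'I_n -> bool}) : 0 <= \prod_(i < n) (if e i then p else 1 - p).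
  by apply: prodr_ge0 => i _; case: ifP.
pose l := 2 * t.
(* Markov's inequality: the exponential weight is at least 1 on the patterns in [Q] and non-negative
   on the others. *)
apply: (@le_trans _ _ (\sum_(e : {ffun 'I_n -> bool})
    expR (- (l * (n%:R * (p + t)))) * (expR (l * \sum_(i < n) (e i)%:R) *
    \prod_(i < n) (if e i then p else 1 - p)))).
  rewrite big_mkcond; apply: ler_sum => e _; case: ifPn => [Qe|_]; last first.
    by rewrite !mulr_ge0// expR_ge0.
  rewrite mulrA -expRD ler_peMl// -[leLHS]expR0 ler_expR addrC -mulrBr.
  by apply: mulr_ge0; [exact: mulr_ge0|rewrite subr_ge0 ltW].
rewrite -big_distrr/=.
(* The moment generating function of the count factors over the observations, by distributivity of
   the product over the sums. *)
rewrite (_ : \sum_(e | _) _ = (p * expR l + (1 - p)) ^+ n); last first.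
  transitivity (\prod_(i < n) \sum_(b : bool) (if b then p * expR l else 1 - p)); last first.
    by under eq_bigr do rewrite big_bool; rewrite prodr_const card_ord.
  rewrite bigA_distr_bigA; apply: eq_bigr => e _ /=.
    rewrite mulr_sumr expR_sum -big_split/=; apply: eq_bigr => i _.
    by case: (e i); [rewrite mulr1 mulrC|rewrite mulr0 expR0 mul1r].
have -> : expR (- (l * (n%:R * (p + t)))) = expR (- (l * p)) ^+ n * expR (- (l * t)) ^+ n.
  by rewrite -exprMn -expRD -expRM_natl; congr expR; ring.
have -> : expR (- (n%:R * t ^+ 2)) = expR (l ^+ 2 / 4) ^+ n * expR (- (l * t)) ^+ n.
  by rewrite -exprMn -expRD -expRM_natl /l; congr expR; field.
rewrite mulrAC ler_wpM2r ?exprn_ge0 ?expR_ge0//.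
rewrite -exprMn mulrC.
have m0 : 0 <= p * expR l + (1 - p) by rewrite addr_ge0// mulr_ge0// expR_ge0.
by rewrite lerXn2r ?nnegrE ?expR_ge0 ?bernoulli_mgf_le// mulr_ge0// expR_ge0.
Qed.

(** A lower deviation for [A] is an upper deviation for its complement, so the one-sided tail is
    applied to both events. *)
Lemma hoeffding_indic A p t : (0 < n)%N -> measurable A ->
  (forall i, P (X i @^-1` A) = p%:E) -> 0 <= t ->
  let S := [set om | t < `|(\sum_(i < n) \1_A (X i om)) / n%:R - p|] in
  measurable S /\ (P S <= (2 * expR (- (n%:R * t ^+ 2)))%:E)%E.
Proof.
move=> n0 mA PA t0 S.
have n0R : 0 < n%:R :> R by rewrite ltr0n.
have p01 : 0 <= p <= 1.
  by rewrite -!lee_fin -(PA (Ordinal n0)) measure_ge0 probability_le1//;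
    apply: measurable_funPTI.
have mAC : measurable (~` A) by exact: measurableC.
have PAC i : P (X i @^-1` (~` A)) = (1 - p)%:E.
  rewrite -[X i @^-1` ~` A]/(~` (X i @^-1` A)) probability_setC ?PA//.
  by apply: measurable_funPTI.
have q01 : 0 <= 1 - p <= 1 by case/andP: p01 => *; apply/andP; split; lra.
have [m1 P1] := tail mA PA p01 t0.
have [m2 P2] := tail mAC PAC q01 t0.
have nE : n%:R = \sum_(i < n) (1 : R) by rewrite sumr_const card_ord.
have sC om : \sum_(i < n) \1_(~` A) (X i om) = n%:R - \sum_(i < n) \1_A (X i om) :> R.
  rewrite [in RHS]nE -sumrB; apply: eq_bigr => i _.
  by rewrite !indicE in_setC; case: (_ \in A); rewrite ?subrr ?subr0.
have SE : S = [set om | n%:R * (p + t) < \sum_(i < n) \1_A (X i om)] `|`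
    [set om | n%:R * (1 - p + t) < \sum_(i < n) \1_(~` A) (X i om)].
  apply/seteqP; split=> om; rewrite /S /= sC; set s := \sum_(i < n) _;
    (have -> : s / n%:R - p = (s - n%:R * p) / n%:R by field; lra);
    rewrite normrM [`|n%:R^-1|]gtr0_norm ?invr_gt0// ltr_pdivlMr// ltr_normr.
    by move=> /orP[h|h]; [left|right]; lra.
  by move=> h; apply/orP; case: h => h; [left|right]; lra.
rewrite SE; split; first exact: measurableU.
apply: (le_trans (measureU2 _ _ _)) => //.
by rewrite mulr2n mulrDl mul1r EFinD leeD.
Qed.

End independent_indicators.

(** * Minimum distance estimation *)

Section minimum_distance.
Context d (T : measurableType d) (R : realType) (mu : {measure set T -> \bar R}).
Implicit Types (f g p : T -> R) (A : set T).

Lemma pdf_integrable f : is_pdf mu f -> mu.-integrable setT (EFin \o f).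
Proof.
move=> [mf f0 f1]; apply/integrableP; split; first exact/measurable_EFinP.
rewrite (_ : integral _ _ _ = 1)%E ?ltry// -f1; apply: ae_eq_integral => //.
- by apply: measurableT_comp => //; exact/measurable_EFinP.
- exact/measurable_EFinP.
- by apply: filterS f0 => x fx0 _ /=; rewrite ger0_norm.
Qed.

Lemma pdf_measurable f : is_pdf mu f -> measurable_fun setT f.
Proof. by case. Qed.

Lemma integrable_pdfB f g : is_pdf mu f -> is_pdf mu g ->
  mu.-integrable setT (EFin \o (fun x => f x - g x)).
Proof.
by move=> pf pg; apply: (integrableB measurableT (f := EFin \o f) (g := EFin \o g));
  exact: pdf_integrable.
Qed.

Lemma integrable_normr_pdfB f g : is_pdf mu f -> is_pdf mu g ->
  mu.-integrable setT (EFin \o (fun x => `|f x - g x|)).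
Proof. by move=> pf pg; apply: integrable_norm; exact: integrable_pdfB. Qed.

Lemma RintegralT_setC A f : measurable A -> mu.-integrable setT (EFin \o f) ->
  \int[mu]_x f x = \int[mu]_(x in A) f x + \int[mu]_(x in ~` A) f x.
Proof.
move=> mA fi; rewrite -Rintegral_setU ?setUv//; first exact: measurableC.
by apply/disj_setPCl.
Qed.

Let RintegralS A f g : measurable A -> is_pdf mu f -> is_pdf mu g ->
  \int[mu]_(x in A) (f x - g x) =
  \int[mu]_(x in A) f x - \int[mu]_(x in A) g x.
Proof.
move=> mA pf pg; rewrite RintegralB//; apply: (integrableS _ _ (@subsetT _ A)) => //;
  exact: pdf_integrable.
Qed.

Let RintegralC A f g : measurable A -> is_pdf mu f -> is_pdf mu g ->
  \int[mu]_(x in ~` A) (f x - g x) =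
  - (\int[mu]_(x in A) f x - \int[mu]_(x in A) g x).
Proof.
move=> mA pf pg; rewrite -RintegralS//; apply/eqP; rewrite -addr_eq0 addrC.
rewrite -RintegralT_setC//; last exact: integrable_pdfB.
rewrite RintegralB//; [|exact: pdf_integrable..].
by case: pf => _ _; case: pg => _ _; rewrite /Rintegral => -> ->; rewrite subrr.
Qed.

(** As both masses are one, [f - g] has opposite integrals over [A] and its complement; each half of
    the domain therefore pays for one copy of the difference. *)
Lemma pdf_integralB_le A f g : measurable A -> is_pdf mu f -> is_pdf mu g ->
  2 * `|\int[mu]_(x in A) f x - \int[mu]_(x in A) g x| <=
  \int[mu]_x `|f x - g x|.
Proof.
move=> mA pf pg; have mAC := measurableC mA.
have ifg := integrable_pdfB pf pg.
rewrite (RintegralT_setC mA); last exact: integrable_normr_pdfB.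
rewrite mulr2n mulrDl !mul1r lerD//.
  rewrite -RintegralS//; apply: le_normr_Rintegral => //.
  by apply: integrableS ifg.
rewrite -normrN -RintegralC//; apply: le_normr_Rintegral => //.
by apply: integrableS ifg.
Qed.

(** Equality holds in the previous bound because [f - g] has constant sign on [A] and on its
    complement. *)
Lemma scheffe f g : is_pdf mu f -> is_pdf mu g ->
  let A := [set x | g x < f x] in
  \int[mu]_x `|f x - g x| =
  2 * (\int[mu]_(x in A) f x - \int[mu]_(x in A) g x).
Proof.
move=> pf pg A.
have mA : measurable A.
  rewrite -[A]setTI; apply: measurable_fun_ltr => //; exact: pdf_measurable.
have mAC := measurableC mA; have ifg := integrable_pdfB pf pg.
rewrite (RintegralT_setC mA); last exact: integrable_normr_pdfB.
rewrite mulr2n mulrDl !mul1r; congr (_ + _).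
  rewrite -RintegralS//; apply: eq_Rintegral => x.
  by rewrite inE /A/= => gf; rewrite gtr0_norm// subr_gt0.
rewrite -[RHS]opprK -RintegralC// -mulN1r -RintegralZl//; last first.
  by apply: integrableS ifg.
apply: eq_Rintegral => x; rewrite inE /A /= => /negP; rewrite -leNgt => fg.
by rewrite mulN1r ler0_norm// subr_le0.
Qed.

Lemma L1_triangle f g h : is_pdf mu f -> is_pdf mu g -> is_pdf mu h ->
  \int[mu]_x `|f x - h x| <= \int[mu]_x `|f x - g x| + \int[mu]_x `|g x - h x|.
Proof.
move=> pf pg ph; rewrite -RintegralD//; try exact: integrable_normr_pdfB.
apply: le_Rintegral => //; first exact: integrable_normr_pdfB.
  by apply: (@integrableD _ _ _ mu setT _ (fun x => `|f x - g x|%:E)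
    (fun x => `|g x - h x|%:E)) => //; exact: integrable_normr_pdfB.
by move=> x _; exact: ler_distD.
Qed.

Definition empirical n A (s : n.-tuple T) : R :=
  (\sum_(i < n) \1_A (tnth s i)) / n%:R.

Section yatracos.
Context (I : finType) (i0 : I) (f : I -> T -> R) (n : nat).
Hypothesis pdf_f : forall i, is_pdf mu (f i).

Definition scheffe_set (i j : I) : set T := [set x | f j x < f i x].

Lemma measurable_scheffe_set i j : measurable (scheffe_set i j).
Proof.
rewrite -[scheffe_set _ _]setTI; apply: measurable_fun_ltr => //;
  exact: pdf_measurable.
Qed.

Let discrepancy (i : I) (s : n.-tuple T) : R :=
  \big[Num.max/0]_(z : I * I)
    `|\int[mu]_(x in scheffe_set z.1 z.2) f i x - empirical (scheffe_set z.1 z.2) s|.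

Definition yatracos (s : n.-tuple T) : I := [arg min_(i < i0) discrepancy i s]%O.

(** The selection depends on the sample only through the finite pattern of memberships of its points
    in the Scheffe sets. Its level sets are thus finite unions of measurable pattern sets, however
    ties are broken. *)
Lemma measurable_yatracos i : measurable [set s | yatracos s = i].
Proof.
pose pattern (s : n.-tuple T) : {ffun (I * I) * 'I_n -> bool} :=
  [ffun z => tnth s z.2 \in scheffe_set z.1.1 z.1.2].
have patternP s s' : pattern s = pattern s' -> yatracos s = yatracos s'.
  move=> ss'; have ds j : discrepancy j s = discrepancy j s'.
    apply: eq_bigr => z _; congr (`|_ - _ / _|); apply: eq_bigr => k _.
    by have /ffunP/(_ (z, k)) := ss'; rewrite !ffunE /= !indicE => ->.
  by rewrite /yatracos /Order.arg_min; congr extremum; apply/funext.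
have -> : [set s | yatracos s = i] = \bigcup_(e in [set e | exists s,
    pattern s = e /\ yatracos s = i]) [set s | pattern s = e].
  apply/seteqP; split=> s /=; first by move=> si; exists (pattern s) => //; exists s.
  by move=> [_ [s' [<- <-]] ] /patternP.
apply: fin_bigcup_measurable => // e _.
rewrite (_ : mkset _ = \bigcap_(z in [set: (I * I) * 'I_n])
    (fun s => tnth s z.2) @^-1`
      (if e z then scheffe_set z.1.1 z.1.2 else ~` scheffe_set z.1.1 z.1.2)).
  apply: fin_bigcap_measurable => // z _.
  rewrite -[X in measurable X]setTI; apply: measurable_tnth => //.
  by case: (e z); [|apply: measurableC]; exact: measurable_scheffe_set.
apply/seteqP; split=> s /=.
  by move=> <- z _ /=; rewrite ffunE; case: ifPn; rewrite ?inE// notin_setE.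
move=> h; apply/ffunP => z; rewrite ffunE; have := h z Logic.I.
by case: (e z) => ?; [rewrite mem_set|rewrite memNset].
Qed.

(** On the Scheffe set of [f i] against the selected density, each of the two is within [N / 2 + t]
    of the empirical measure. Scheffe's identity doubles the sum to [2 N + 4 t], and the triangle
    inequality through [f i] adds [N]. *)
Lemma yatracos_dist_le p (s : n.-tuple T) (t : R) i : is_pdf mu p ->
  (forall j k, `|empirical (scheffe_set j k) s -
                 \int[mu]_(x in scheffe_set j k) p x| <= t) ->
  \int[mu]_x `|p x - f (yatracos s) x| <=
  3 * \int[mu]_x `|p x - f i x| + 4 * t.
Proof.
move=> pp tP; set N := \int[mu]_x `|p x - f i x|.
have discr j z : `|\int[mu]_(x in scheffe_set z.1 z.2) f j x -
    empirical (scheffe_set z.1 z.2) s| <= discrepancy j s.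
  exact: (le_bigmax _ (fun z : I * I => `|\int[mu]_(x in scheffe_set z.1 z.2) f j x -
    empirical (scheffe_set z.1 z.2) s|)).
have t0 : 0 <= t by apply: le_trans (tP i i).
(* Passing through [p] costs [N / 2] from [f i] to [p] and [t] from [p] to the empirical measure. *)
have di : discrepancy i s <= N / 2 + t.
  apply/bigmax_leP; split=> [|z _].
    by rewrite addr_ge0// divr_ge0// Rintegral_ge0.
  have mz := measurable_scheffe_set z.1 z.2.
  apply: le_trans (ler_distD (\int[mu]_(x in scheffe_set z.1 z.2) p x) _ _) _.
  apply: lerD; last by rewrite distrC.
  by rewrite distrC ler_pdivlMr// mulrC; exact: pdf_integralB_le.
have dy : discrepancy (yatracos s) s <= discrepancy i s.
  by rewrite /yatracos; case: arg_minP => // j _; apply.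
have fy : \int[mu]_x `|f i x - f (yatracos s) x| <= 2 * (N + 2 * t).
  rewrite scheffe//; set A := mkset _.
  have := discr i (i, yatracos s); have := discr (yatracos s) (i, yatracos s).
  rewrite /= -[scheffe_set _ _]/A.
  by rewrite !ler_norml => /andP[h1 h2] /andP[h3 h4]; lra.
apply: (le_trans (L1_triangle pp (pdf_f i) (pdf_f _))).
by rewrite -/N; lra.
Qed.

End yatracos.
End minimum_distance.

(** * Product densities and the Lebesgue measure on tuples *)

Section lebesgue_tuple.
Context (R : realType).
Local Notation mu := (@lebesgue_measure R).
Local Open Scope ereal_scope.

(** Tonelli's theorem, carried through the pushforward that defines the measure on tuples; it drives
    the inductions on [d] below. *)
Lemma ge0_integral_lebesgue_tupleS d (F : Rvec R d.+1 -> \bar R) :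
  measurable_fun setT F -> (forall x, 0 <= F x) ->
  \int[lebesgue_tuple d.+1]_x F x =
  \int[mu]_x \int[lebesgue_tuple d]_t F (tcons (x, t)).
Proof.
move=> mF F0; rewrite /= (ge0_integral_pushforward (@measurable_tcons _ _ _))//.
rewrite preimage_setT fubini_tonelli1//=.
by apply: measurableT_comp => //; exact: measurable_tcons.
Qed.

Lemma measurable_tcons_section d (F : Rvec R d.+1 -> \bar R) x :
  measurable_fun setT F -> measurable_fun setT (fun t => F (tcons (x, t))).
Proof.
move=> mF; apply: (measurableT_comp mF).
apply: (measurableT_comp (@measurable_tcons _ _ _)).
exact: measurable_pair1.
Qed.

Lemma measurable_integral_tcons d (F : Rvec R d.+1 -> \bar R) :
  measurable_fun setT F -> (forall x, 0 <= F x) ->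
  measurable_fun setT (fun x => \int[lebesgue_tuple d]_t F (tcons (x, t))).
Proof.
move=> mF F0; apply: (@measurable_fun_fubini_tonelli_F _ _ _ _ _
  (lebesgue_tuple d) (F \o @tcons _ _ _)) => //=.
by apply: measurableT_comp => //; exact: measurable_tcons.
Qed.

Lemma measurable_prod_tnth d (f : 'I_d -> measurableTypeR R -> R) :
  (forall j, measurable_fun setT (f j)) ->
  measurable_fun setT (fun x : Rvec R d => (\prod_(j < d) f j (tnth x j))%R).
Proof.
move=> mf; apply: measurable_prod => j _.
by apply: measurableT_comp => //; exact: measurable_tnth.
Qed.

Lemma integral_prod_tnth d (f : 'I_d -> measurableTypeR R -> R) :
  (forall j, measurable_fun setT (f j)) -> (forall j x, (0 <= f j x)%R) ->
  \int[lebesgue_tuple d]_x (\prod_(j < d) f j (tnth x j))%:E =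
  \prod_(j < d) \int[mu]_x (f j x)%:E.
Proof.
elim: d f => [|d IH] f mf f0.
  rewrite big_ord0 [lebesgue_tuple 0]/= integral_dirac//.
    by rewrite diracT mul1e big_ord0.
  by apply/measurable_EFinP; exact: measurable_prod_tnth.
have F0 (x : Rvec R d.+1) : 0 <= (\prod_(j < d.+1) f j (tnth x j))%:E.
  by rewrite lee_fin prodr_ge0.
rewrite ge0_integral_lebesgue_tupleS//; last first.
  by apply/measurable_EFinP; exact: measurable_prod_tnth.
rewrite big_ord_recl.
rewrite -(IH (fun j => f (lift ord0 j)))//.
rewrite -ge0_integralZr//; last 3 first.
- exact/measurable_EFinP.
- by move=> x _; rewrite lee_fin.
- by apply: integral_ge0 => x _; rewrite lee_fin prodr_ge0.
apply: eq_integral => x _; rewrite -ge0_integralZl//; last 3 first.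
- apply/measurable_EFinP.
  exact: (measurable_prod_tnth (fun j => mf (lift ord0 j))).
- by move=> t _; rewrite lee_fin prodr_ge0.
- by rewrite lee_fin.
apply: eq_integral => t _; rewrite big_ord_recl -EFinM.
by congr (_ * _)%:E%R; apply: eq_bigr => j _; rewrite tnthS.
Qed.

(** Telescoping by induction on [d]: one factor is exchanged at a time, and the factors left
    unchanged integrate to one. *)
Lemma L1_prod_tnth_le d (f g : 'I_d -> measurableTypeR R -> R) :
  (forall j, is_pdf mu (f j)) -> (forall j, is_pdf mu (g j)) ->
  (forall j x, (0 <= f j x)%R) -> (forall j x, (0 <= g j x)%R) ->
  \int[lebesgue_tuple d]_x `|\prod_(j < d) f j (tnth x j) -
                             \prod_(j < d) g j (tnth x j)|%:E <=
  \sum_(j < d) \int[mu]_x `|f j x - g j x|%:E.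
Proof.
elim: d f g => [|d IH] f g pf pg f0 g0.
  by under eq_integral do rewrite !big_ord0 subrr normr0; rewrite integral0 big_ord0.
have mf j : measurable_fun setT (f j) := pdf_measurable (pf j).
have mg j : measurable_fun setT (g j) := pdf_measurable (pg j).
have mfg j : measurable_fun setT (fun x => `|f j x - g j x|%:E).
  by apply/measurable_EFinP; apply: measurableT_comp => //; exact: measurable_funB.
pose pi0 (h : 'I_d.+1 -> measurableTypeR R -> R) (t : Rvec R d) : R :=
  (\prod_(j < d) h (lift ord0 j) (tnth t j))%R.
have prodS (h : 'I_d.+1 -> measurableTypeR R -> R) x (t : Rvec R d) :
    (\prod_(j < d.+1) h j (tnth (tcons (x, t)) j) = h ord0 x * pi0 h t)%R.
  by rewrite big_ord_recl; congr (_ * _)%R; apply: eq_bigr => j _; rewrite tnthS.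
have mpi h : (forall j, measurable_fun setT (h j)) -> measurable_fun setT (pi0 h).
  by move=> mh; exact: (measurable_prod_tnth (fun j => mh (lift ord0 j))).
have mpf := mpi f mf; have mpg := mpi g mg.
have mpfg : measurable_fun setT (fun t => `|pi0 f t - pi0 g t|%:E).
  by apply/measurable_EFinP; apply: measurableT_comp => //; exact: measurable_funB.
have pi_ge0 h : (forall j x, (0 <= h j x)%R) -> forall t, (0 <= pi0 h t)%R.
  by move=> h0 t; rewrite prodr_ge0.
have pif1 : \int[lebesgue_tuple d]_t (pi0 f t)%:E = 1.
  apply: (etrans (integral_prod_tnth (fun j => mf (lift ord0 j)) _)) => //.
  by rewrite big1// => j _; case: (pf (lift ord0 j)).
pose F (x : Rvec R d.+1) : \bar R :=
  `|\prod_(j < d.+1) f j (tnth x j) - \prod_(j < d.+1) g j (tnth x j)|%:E.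
have F0 x : 0 <= F x by rewrite lee_fin.
have mF : measurable_fun setT F.
  apply/measurable_EFinP; apply: measurableT_comp => //.
  by apply: measurable_funB; exact: measurable_prod_tnth.
rewrite (ge0_integral_lebesgue_tupleS mF)//.
pose N := \int[lebesgue_tuple d]_t `|pi0 f t - pi0 g t|%:E.
have N0 : 0 <= N by exact: integral_ge0.
apply: (@le_trans _ _ (\int[mu]_x (`|f ord0 x - g ord0 x|%:E + (g ord0 x)%:E * N))).
  apply: ge0_le_integral => //.
  - by move=> x _; apply: integral_ge0.
  - exact: measurable_integral_tcons.
  - apply: emeasurable_funD => //; apply: emeasurable_funM => //.
    exact/measurable_EFinP.
  move=> x _.
  apply: (@le_trans _ _ (\int[lebesgue_tuple d]_t
      (`|f ord0 x - g ord0 x|%:E * (pi0 f t)%:E +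
      (g ord0 x)%:E * `|pi0 f t - pi0 g t|%:E))).
    apply: ge0_le_integral => //.
    + exact: measurable_tcons_section.
    + apply: emeasurable_funD; apply: emeasurable_funM => //.
      exact/measurable_EFinP.
    move=> t _; rewrite /F !prodS -!EFinM -EFinD lee_fin.
    (* The exchange of the first factor is charged to the remaining factors of [f], that of the
       remaining factors to the first factor of [g]. *)
    rewrite (_ : (f ord0 x * pi0 f t - g ord0 x * pi0 g t =
      (f ord0 x - g ord0 x) * pi0 f t + g ord0 x * (pi0 f t - pi0 g t))%R); last by ring.
    rewrite (le_trans (ler_normD _ _))// !normrM.
    by rewrite (ger0_norm (pi_ge0 _ _ _))// (ger0_norm (g0 _ _)).
  rewrite ge0_integralD//; last 4 first.
  - by move=> t _; rewrite mule_ge0// lee_fin// pi_ge0.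
  - by apply: emeasurable_funM => //; exact/measurable_EFinP.
  - by move=> t _; rewrite mule_ge0// lee_fin.
  - by apply: emeasurable_funM.
  rewrite ge0_integralZl//; last 2 first.
  - exact/measurable_EFinP.
  - by move=> t _; rewrite lee_fin pi_ge0.
  rewrite pif1 mule1 ge0_integralZl// lee_fin.
  by [].
rewrite ge0_integralD//; last 2 first.
- by move=> x _; rewrite mule_ge0// lee_fin.
- by apply: emeasurable_funM => //; exact/measurable_EFinP.
rewrite ge0_integralZr//; last 2 first.
- exact/measurable_EFinP.
- by move=> x _; rewrite lee_fin.
case: (pg ord0) => _ _ ->; rewrite mul1e big_ord_recl leeD2l//.
exact: (IH (fun j => f (lift ord0 j)) (fun j => g (lift ord0 j))).
Qed.

End lebesgue_tuple.

(** * Approximation of Lipschitz densities by histograms *)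

Section grid_weights.
Context (R : realType) (m M : nat).
Implicit Types (u : {ffun 'I_m -> 'I_M.+1}) (a : 'I_m.+1 -> R).

(* A point of the simplex with denominator [M], given by all its coordinates
   but the first; families with sum above [M] stand for a vertex. *)
Definition grid_weight u (i : 'I_m.+1) : R :=
  if (\sum_(j < m) u j <= M)%N then
    if unlift ord0 i is Some j then (u j)%:R / M%:R
    else 1 - \sum_(j < m) (u j)%:R / M%:R
  else (i == ord0)%:R.

Lemma grid_weight_ge0 u i : 0 <= grid_weight u i.
Proof.
rewrite /grid_weight; case: ifPn => [uM|_]; last by rewrite ler0n.
case: (unlift _ _) => [j|]; first by rewrite divr_ge0.
(* For [M = 0] the quotients are 0, because the inverse of 0 is 0. *)
rewrite subr_ge0 -mulr_suml -natr_sum; have [M0|M0] := posnP M.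
  by rewrite (_ : M%:R = 0 :> R) ?invr0 ?mulr0// M0.
by rewrite ler_pdivrMr ?ltr0n// mul1r ler_nat.
Qed.

Lemma sum_grid_weight u : \sum_i grid_weight u i = 1.
Proof.
rewrite big_ord_recl /grid_weight unlift_none; case: ifPn => uM.
  by under [X in _ + X]eq_bigr do rewrite liftK; rewrite subrK.
by rewrite big1 ?addr0// => i _; rewrite eq_sym (negbTE (neq_lift _ _)).
Qed.

(** Every coordinate but the first is rounded down, at a total cost of at most [m / M]. The first
    coordinate absorbs both this loss and the missing mass [1 - \sum_i a i], whence the factor 2. *)
Lemma grid_weight_approx a : (0 < M)%N -> (forall i, 0 <= a i) ->
  \sum_i a i <= 1 -> exists u, \sum_i `|a i - grid_weight u i| <=
    (1 - \sum_i a i) + 2 * m%:R / M%:R.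
Proof.
move=> M0 a0 a1; have M0R : 0 < M%:R :> R by rewrite ltr0n.
have ai1 i : a i <= 1.
  by apply: le_trans a1; rewrite (bigD1 i)//= lerDl sumr_ge0.
have Ma0 i : 0 <= M%:R * a i by rewrite mulr_ge0.
have tM i : (Num.trunc (M%:R * a i) < M.+1)%N.
  rewrite truncn_lt_nat//; apply: (@le_lt_trans _ _ M%:R); last by rewrite ltr_nat.
  by rewrite ler_piMr.
pose u : {ffun 'I_m -> 'I_M.+1} :=
  [ffun j => Ordinal (tM (lift ord0 j))].
have uE j : (u j)%:R / M%:R <= a (lift ord0 j) <= (u j)%:R / M%:R + M%:R^-1.
  have /andP[h1 h2] := truncn_itv (Ma0 (lift ord0 j)).
  rewrite ffunE /= -[X in _ + X]mul1r -mulrDl natr1.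
  by rewrite ler_pdivrMr// ler_pdivlMr// (mulrC (a _)) h1 ltW.
(* Rounding down keeps the sum within [M], so [u] is not one of the degenerate codes. *)
have uM : (\sum_(j < m) u j <= M)%N.
  rewrite -(ler_nat R) natr_sum -[leRHS]mul1r -ler_pdivrMr// mulr_suml.
  apply: le_trans a1; rewrite big_ord_recl -[leLHS]add0r lerD// ler_sum// => j _.
  by case/andP: (uE j).
exists u; rewrite big_ord_recl [in leRHS]big_ord_recl /grid_weight uM unlift_none.
under [X in _ + X <= _]eq_bigr do rewrite liftK.
set A := \sum_(i < m) a _; set U := \sum_(i < m) (u i)%:R / M%:R.
have AU : \sum_(i < m) `|a (lift ord0 i) - (u i)%:R / M%:R| = A - U.
  rewrite -sumrB; apply: eq_bigr => i _; rewrite ger0_norm// subr_ge0.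
  by case/andP: (uE i).
have UA : U <= A by apply: ler_sum => i _; case/andP: (uE i).
have AUm : A - U <= m%:R / M%:R.
  have -> : m%:R / M%:R = \sum_(i < m) M%:R^-1 :> R.
    by rewrite sumr_const card_ord mulr_natl.
  by rewrite lerBlDl -big_split/=; apply: ler_sum => i _; case/andP: (uE i).
have a1' : a ord0 + A <= 1 by move: a1; rewrite big_ord_recl.
rewrite AU ler0_norm; last lra.
by rewrite -[2 * _ / _]mulrA; lra.
Qed.

End grid_weights.

Lemma lipschitz_const_ge0 (R : realType) (q : R -> R) (l : R) :
  (forall x y, `|q x - q y| <= l * `|x - y|) -> 0 <= l.
Proof.
by move=> /(_ 1 0); rewrite subr0 normr1 mulr1; apply: le_trans.
Qed.

(** * Mean deviation of a Lipschitz function on one bin *)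

Section lipschitz_bin.
Context (R : realType).
Local Notation mu := (@lebesgue_measure R).
Variables (a b : R).
Hypothesis ab : a < b.
Local Notation D := (`[a, b[%classic : set (measurableTypeR R)).

Lemma continuous_integrable_co (f : R -> R) : continuous f ->
  mu.-integrable D (EFin \o f).
Proof.
move=> cf; apply: (@integrableS _ _ _ mu `[a, b]%classic) => //.
  by apply: subset_itvl; rewrite bnd_simp.
apply: continuous_compact_integrable; first exact: segment_compact.
exact: continuous_subspaceT.
Qed.

Let Rintegral_cst_co (r : R) : \int[mu]_(x in D) r = r * (b - a).
Proof. have muD : mu D = (b - a)%:E.
  by apply: (etrans (lebesgue_measure_itv `[a, b[)); rewrite /= lte_fin ab.
by transitivity (r * fine (mu D)); [exact: Rintegral_cst|rewrite muD]. Qed.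

(** This expansion serves twice below: to show that the mean minimises the quadratic deviation, and
    to obtain a Cauchy-Schwarz inequality. *)
Lemma Rintegral_sqrB_cst (f : R -> R) (r : R) : continuous f ->
  \int[mu]_(x in D) (f x - r) ^+ 2 = \int[mu]_(x in D) f x ^+ 2 -
    2 * r * \int[mu]_(x in D) f x + r ^+ 2 * (b - a).
Proof.
move=> cf; have cf2 : continuous (fun x => f x ^+ 2).
  by move=> x; under eq_fun do rewrite expr2; apply: continuousM; exact: cf.
transitivity (\int[mu]_(x in D) ((f x ^+ 2 - 2 * r * f x) + r ^+ 2)).
  by apply: eq_Rintegral => x _; ring.
have crf : continuous (fun x => 2 * r * f x).
  by move=> x; apply: cvgM; [exact: cvg_cst|exact: cf].
rewrite RintegralD//; last 2 first.
- apply: continuous_integrable_co => x.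
  by apply: cvgB; [exact: cf2|exact: crf].
- by apply: continuous_integrable_co => x; exact: cvg_cst.
rewrite RintegralB//; [|exact: continuous_integrable_co..].
by rewrite RintegralZl// ?Rintegral_cst_co//; exact: continuous_integrable_co.
Qed.

(** The variance [(b - a)^2 / 12] of the uniform law, times the length of the bin. *)
Lemma Rintegral_sqr_center :
  \int[mu]_(x in D) (x - (a + b) / 2) ^+ 2 = (b - a) ^+ 3 / 12.
Proof.
set c := (a + b) / 2.
have cid : continuous (fun x : R => (x - c) ^+ 2).
  move=> x; under eq_fun do rewrite expr2.
  by apply: cvgM; apply: cvgB; (exact: cvg_id || exact: cvg_cst).
rewrite Rintegral_itv_bndo_bndc; last exact: continuous_integrable_co.
pose F := fun x : R => (x - c) ^+ 3 / 3.
have dF x : is_derive x (1 : R) F ((x - c) ^+ 2).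
  by apply: is_derive_eq; rewrite /GRing.scale /=; field.
rewrite /Rintegral (@continuous_FTC2 _ _ F)//.
- by rewrite -EFinB /= /F /c; field.
- exact: continuous_subspaceT.
- have cF : continuous F.
    by move=> x; apply/differentiable_continuous/derivable1_diffP.
  split.
  + by move=> x _.
  + exact/cvg_at_right_filter/cF.
  + exact/cvg_at_left_filter/cF.
by move=> x _; rewrite derive1E; exact: derive_val.
Qed.

Variables (q : R -> R) (l : R).
Hypothesis lip_q : forall x y, `|q x - q y| <= l * `|x - y|.

Lemma lipschitz_continuous : continuous q.
Proof.
have l0 := lipschitz_const_ge0 lip_q.
move=> x; apply/cvgrPdist_le => e e0.
have d0 : 0 < e / (l + 1) by rewrite divr_gt0// ltr_wpDl.
near=> y; apply: (le_trans (lip_q _ _)).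
apply: (@le_trans _ _ (l * (e / (l + 1)))).
  by apply: ler_wpM2l.
rewrite mulrCA ler_piMr// ?ltW//.
by rewrite ltr_pdivrMr ?ltr_wpDl// mul1r ltrDl.
Unshelve. all: by end_near. Qed.

(* [sqrt 3 / 6 = 1 / sqrt 12]: the mean minimises the quadratic deviation, so it
   does better than the value of [q] at the middle of the bin. *)
Lemma lipschitz_mean_deviation :
  \int[mu]_(x in D) `|q x - (\int[mu]_(y in D) q y) / (b - a)| <=
  Num.sqrt 3 / 6 * l * (b - a) ^+ 2.
Proof.
have l0 := lipschitz_const_ge0 lip_q.
have cq := lipschitz_continuous; have h0 : 0 < b - a by rewrite subr_gt0.
have h0' := ltW h0.
set h := b - a; set A := _ / h; set E := \int[mu]_(x in D) _.
have cqA (r : R) : continuous (fun x => q x - r).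
  by move=> x; apply: continuousB; [exact: cq|exact: cvg_cst].
pose c := (a + b) / 2.
(* Around the midpoint value, the Lipschitz condition compares [q] with the identity. *)
have V1 : \int[mu]_(x in D) (q x - q c) ^+ 2 <= l ^+ 2 * (h ^+ 3 / 12).
  have csq (f : R -> R) : continuous f -> continuous (fun x => f x ^+ 2).
    by move=> cf x; under eq_fun do rewrite expr2; apply: continuousM; exact: cf.
  have cxc : continuous (fun x : R => x - c).
    by move=> x; apply: cvgB; (exact: cvg_id || exact: cvg_cst).
  rewrite -Rintegral_sqr_center -RintegralZl//; last first.
    by apply: continuous_integrable_co; exact: csq.
  apply: le_Rintegral => //.
  - by apply: continuous_integrable_co; exact: csq.
  - apply: (@continuous_integrable_co (fun x => l ^+ 2 * (x - c) ^+ 2)) => x.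
    by apply: cvgM; [exact: cvg_cst|exact: (csq (fun x => x - c))].
  - move=> x _; rewrite -exprMn -[leLHS]real_normK ?num_real//.
    rewrite -[leRHS]real_normK ?num_real// normrM (ger0_norm l0).
    by rewrite lerXn2r ?nnegrE ?mulr_ge0//.
(* The two quadratic deviations differ by [h * (A - q c)^2]. *)
have S1 : \int[mu]_(x in D) (q x - A) ^+ 2 <= l ^+ 2 * (h ^+ 3 / 12).
  apply: le_trans V1; rewrite !Rintegral_sqrB_cst//.
  have -> : \int[mu]_(x in D) q x = A * h by rewrite /A divfK// gt_eqF.
  rewrite -subr_ge0 (_ : _ - _ = (b - a) * (A - q c) ^+ 2); last by rewrite /h; ring.
  by rewrite mulr_ge0 ?sqr_ge0// ltW.
(* Cauchy-Schwarz, from the non-negativity of the quadratic deviation of [|q - A|] around its own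
   mean [E / h]. *)
have S2 : E ^+ 2 <= h * (l ^+ 2 * (h ^+ 3 / 12)).
  have cn : continuous (fun x => `|q x - A|).
    by move=> x; apply: cvg_norm; exact: cqA.
  have : 0 <= \int[mu]_(x in D) (`|q x - A| - E / h) ^+ 2.
    by apply: Rintegral_ge0 => x _; rewrite sqr_ge0.
  rewrite Rintegral_sqrB_cst// -/E -/h.
  under eq_Rintegral do rewrite real_normK ?num_real//.
  have -> : 2 * (E / h) * E = 2 * (E ^+ 2 / h) by ring.
  have -> : (E / h) ^+ 2 * h = E ^+ 2 / h by field; rewrite gt_eqF.
  move=> hE; have -> : E ^+ 2 = h * (E ^+ 2 / h) by field; rewrite gt_eqF.
  by apply: ler_wpM2l; [exact: ltW|lra].
have E0 : 0 <= E by apply: Rintegral_ge0.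
(* The squares are compared: [(sqrt 3 / 6)^2 = 1 / 12]. *)
rewrite -(ler_pXn2r (n := 2))// ?nnegrE ?mulr_ge0 ?sqr_ge0 ?divr_ge0 ?sqrtr_ge0//.
apply: (le_trans S2); rewrite !exprMn sqr_sqrtr// le_eqVlt; apply/orP; left.
by apply/eqP; field.
Qed.

End lipschitz_bin.

(** * Histograms with [b] equal bins on the unit interval *)

Section histogram.
Context (R : realType) (b : nat).
Hypothesis b_gt0 : (0 < b)%N.
Local Notation mu := (@lebesgue_measure R).
Local Notation RT := (measurableTypeR R).
Implicit Types (v : 'I_b -> R) (x : RT).

(** Half-open, so that the first [b] bins partition [[0, 1[]. *)
Definition bin (i : nat) : set RT := `[i%:R / b%:R, i.+1%:R / b%:R[%classic.

(** [v i] is the mass of a bin, hence the factor [b], the inverse of the bin width. *)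
Definition hist v x : R := \sum_(i < b) v i * b%:R * \1_(bin i) x.

Let b0 : 0 < b%:R :> R. Proof. by rewrite ltr0n. Qed.

Lemma measurable_bin i : measurable (bin i).
Proof. exact: measurable_itv. Qed.

Let bin_lt (i : nat) : i%:R / b%:R < i.+1%:R / b%:R :> R.
Proof. by rewrite ltr_pM2r ?invr_gt0// ltr_nat. Qed.

Let bin_width (i : nat) : i.+1%:R / b%:R - i%:R / b%:R = b%:R^-1 :> R.
Proof. by rewrite -mulrBl -natrB// subSnn mul1r. Qed.

Lemma lebesgue_measure_bin i : mu (bin i) = (b%:R^-1)%:E.
Proof.
apply: (etrans (lebesgue_measure_itv `[i%:R / b%:R, i.+1%:R / b%:R[)).
by rewrite /= lte_fin bin_lt -EFinB bin_width.
Qed.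

Lemma sum_indic_bin m x :
  \sum_(i < m) \1_(bin i) x = \1_(`[0, m%:R / b%:R[%classic : set RT) x :> R.
Proof.
elim: m => [|m IH].
  by rewrite big_ord0 mul0r set_itv_ge ?bnd_simp// indicE in_set0.
rewrite big_ord_recr/= IH !indicE /bin.
have m0 : 0 <= m%:R / b%:R :> R by rewrite divr_ge0.
have mS := bin_lt m.
rewrite !mem_setE !in_itv/=.
have [xm|xm] := ltP x (m%:R / b%:R).
  by rewrite andbT andFb addr0 (lt_trans xm mS) andbT.
by rewrite andbF add0r (le_trans m0 xm).
Qed.

Let sum_indic_unit x : \sum_(i < b) \1_(bin i) x = \1_(`[0, 1[%classic : set RT) x :> R.
Proof. by rewrite sum_indic_bin divff// gt_eqF. Qed.

Lemma hist_ge0 v x : (forall i, 0 <= v i) -> 0 <= hist v x.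
Proof. by move=> v0; apply: sumr_ge0 => i _; rewrite !mulr_ge0. Qed.

Lemma hist_eq0 v x : ~ (0 <= x <= 1) -> hist v x = 0.
Proof.
move=> x01; apply: big1 => i _.
suff -> : \1_(bin i) x = 0 :> R by rewrite mulr0.
have /eqP : \sum_(i < b) \1_(bin i) x = 0 :> R.
  rewrite sum_indic_unit indicE memNset//= in_itv/= => /andP[x0 /ltW x1].
  by apply: x01; rewrite x0.
by rewrite psumr_eq0// => /allP/(_ i) /(_ (mem_index_enum _))/eqP.
Qed.

Lemma measurable_hist v : measurable_fun setT (hist v).
Proof.
apply: measurable_sum => i; apply: measurable_funM => //.
by apply: measurable_indic; exact: measurable_bin.
Qed.

Lemma is_pdf_hist v : (forall i, 0 <= v i) -> \sum_i v i = 1 ->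
  is_pdf mu (hist v).
Proof.
move=> v0 v1; split; first exact: measurable_hist.
  by apply: aeW => x; exact: hist_ge0.
under eq_integral do rewrite /hist -sumEFin.
rewrite ge0_integral_sum//; last 2 first.
- move=> i; apply/measurable_EFinP; apply: measurable_funM => //.
  by apply: measurable_indic; exact: measurable_bin.
- by move=> i x _; rewrite lee_fin !mulr_ge0.
transitivity ((\sum_i v i)%:E); last by rewrite v1.
rewrite -sumEFin; apply: eq_bigr => i _.
under eq_integral do rewrite EFinM.
rewrite ge0_integralZl//; last 2 first.
- by apply/measurable_EFinP; apply: measurable_indic; exact: measurable_bin.
- by rewrite lee_fin mulr_ge0.
rewrite integral_indic//; last exact: measurable_bin.
by rewrite setIT [X in (_ * X)%E]lebesgue_measure_bin -EFinM mulfK ?gt_eqF.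
Qed.

Let integral_indicM (f : RT -> R) i :
  (\int[mu]_x (\1_(bin i) x * f x)%:E = \int[mu]_(x in bin i) (f x)%:E)%E.
Proof.
rewrite [RHS]integral_mkcond; apply: eq_integral => x _.
by rewrite patchE indicE; case: (x \in bin i); rewrite ?mul1r ?mul0r.
Qed.

Section approximation.
Variables (q : RT -> R) (l : R).
Hypothesis (pdf_q : is_pdf mu q) (q_ge0 : forall x, 0 <= q x).
Hypothesis lip_q : forall x y, `|q x - q y| <= l * `|x - y|.
Hypothesis supp_q : (\int[mu]_(x in `[0%R, 1%R]) (q x)%:E = 1)%E.

Definition bin_mass (i : 'I_b) : R := \int[mu]_(x in bin i) q x.

Lemma bin_mass_ge0 i : 0 <= bin_mass i.
Proof. exact: Rintegral_ge0. Qed.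

Let mq : measurable_fun setT q := pdf_measurable pdf_q.

Let integralq1 : (\int[mu]_x (\1_(`[0%R, 1%R[%classic : set RT) x * q x)%:E = 1)%E.
Proof.
rewrite -supp_q -integral_itv_bndo_bndc; last first.
  exact/measurable_EFinP/measurable_funTS.
rewrite [RHS]integral_mkcond; apply: eq_integral => x _.
by rewrite patchE indicE; case: (x \in _); rewrite ?mul1r ?mul0r.
Qed.

Let mass_fin (i : 'I_b) : (\int[mu]_(x in bin i) (q x)%:E = (bin_mass i)%:E)%E.
Proof.
rewrite /bin_mass /Rintegral fineK//; apply: integrable_fin_num.
  exact: measurable_bin.
by apply: integrableS (pdf_integrable pdf_q) => //; exact: measurable_bin.
Qed.

Lemma sum_bin_mass : \sum_i bin_mass i = 1.
Proof.
apply: EFin_inj; rewrite -sumEFin -integralq1.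
under eq_integral do rewrite -sum_indic_unit mulr_suml -sumEFin.
rewrite ge0_integral_sum//.
- by apply: eq_bigr => i _; rewrite integral_indicM ?mass_fin.
- move=> i; apply/measurable_EFinP; apply: measurable_funM => //.
  by apply: measurable_indic; exact: measurable_bin.
- by move=> i x _; rewrite lee_fin mulr_ge0.
Qed.

(** On each bin, [q] is first replaced by its mean [b * bin_mass i], at the cost of the deviation
    bound, and then this height is changed to [b * v i], at the cost of the difference of masses. *)
Lemma L1_hist_le v : (\int[mu]_x `|q x - hist v x|%:E <=
  (Num.sqrt 3 / (6 * b%:R) * l + \sum_i `|bin_mass i - v i|)%:E)%E.
Proof.
pose o (x : RT) : R := 1 - \1_(`[0, 1[%classic : set RT) x.
have o0 x : 0 <= o x by rewrite /o indicE; case: (_ \in _); rewrite ?subrr ?subr0.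
have mo : measurable_fun setT o.
  by apply: measurable_funB => //; apply: measurable_indic; exact: measurable_itv.
have m1 i : measurable_fun setT (\1_(bin i) : RT -> R).
  by apply: measurable_indic; exact: measurable_bin.
have mdev i : measurable_fun setT (fun x => `|q x - b%:R * bin_mass i|).
  by apply: measurableT_comp => //; exact: measurable_funB.
(* [q] and its restriction to [[0, 1[] both have mass one, so nothing is left outside. *)
have qo : (\int[mu]_x (o x * q x)%:E = 0)%E.
  have := integralq1; have [_ _ <-] := pdf_q.
  rewrite [X in _ = X -> _](_ : _ = \int[mu]_x (\1_(`[0%R, 1%R[%classic : set RT) x * q x)%:E
      + \int[mu]_x (o x * q x)%:E)%E; last first.
    rewrite -ge0_integralD//; last 4 first.
    - by move=> x _; rewrite lee_fin mulr_ge0.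
    - by apply/measurable_EFinP; apply: measurable_funM.
    - by move=> x _; rewrite lee_fin mulr_ge0.
    - by apply/measurable_EFinP; apply: measurable_funM.
    by apply: eq_integral => x _; rewrite -EFinD -mulrDl /o addrC subrK mul1r.
  rewrite integralq1; set z := integral _ _ _.
  have : (0 <= z)%E by apply: integral_ge0 => x _; rewrite lee_fin mulr_ge0.
  case: z => [z|//|//]; rewrite -EFinD => z0 [] h.
  by congr EFin; lra.
apply: (@le_trans _ _ (\int[mu]_x ((o x * q x)%:E +
    \sum_(i < b) ((\1_(bin i) x * `|q x - b%:R * bin_mass i|)%:E +
    (`|bin_mass i - v i| * b%:R * \1_(bin i) x)%:E)))%E).
  apply: ge0_le_integral => //.
  - apply/measurable_EFinP; apply: measurableT_comp => //.
    by apply: measurable_funB => //; exact: measurable_hist.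
  - apply: emeasurable_funD; first by apply/measurable_EFinP; exact: measurable_funM.
    apply: emeasurable_sum => i; apply: emeasurable_funD; apply/measurable_EFinP;
      exact: measurable_funM.
  move=> x _; under [X in (_ <= _ + X)%E]eq_bigr do rewrite -EFinD.
  rewrite sumEFin -EFinD lee_fin.
  have -> : q x - hist v x = o x * q x + \sum_(i < b) (\1_(bin i) x *
      (q x - b%:R * bin_mass i) + (bin_mass i - v i) * b%:R * \1_(bin i) x).
    rewrite /o -sum_indic_unit mulrBl mul1r mulr_suml -addrA; congr (_ + _).
    rewrite /hist -sumrN -[X in _ = X + _]sumrN -big_split/=; apply: eq_bigr => i _; ring.
  apply: (le_trans (ler_normD _ _)); rewrite ger0_norm ?mulr_ge0//; apply: lerD => //.
  apply: (le_trans (ler_norm_sum _ _ _)); apply: ler_sum => i _.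
  apply: (le_trans (ler_normD _ _)); rewrite !normrM.
  by rewrite (@ger0_norm _ (\1_(bin i) x))// (@ger0_norm _ b%:R).
have msum (i : 'I_b) : measurable_fun setT (fun x =>
    (\1_(bin i) x * `|q x - b%:R * bin_mass i|)%:E)%E.
  by apply/measurable_EFinP; exact: measurable_funM.
have msum' (i : 'I_b) : measurable_fun setT (fun x =>
    (`|bin_mass i - v i| * b%:R * \1_(bin i) x)%:E)%E.
  by apply/measurable_EFinP; exact: measurable_funM.
rewrite ge0_integralD//; last 4 first.
- by move=> x _; rewrite lee_fin mulr_ge0.
- by apply/measurable_EFinP; exact: measurable_funM.
- move=> x _; apply: sume_ge0 => i _; rewrite -EFinD lee_fin addr_ge0// !mulr_ge0//.
- by apply: emeasurable_sum => i; exact: emeasurable_funD.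
rewrite qo add0e ge0_integral_sum//; last 2 first.
- by move=> i; exact: emeasurable_funD.
- by move=> i x _; rewrite -EFinD lee_fin addr_ge0// !mulr_ge0.
(* There are [b] bins of width [1 / b], each contributing a multiple of the squared width. *)
have -> : Num.sqrt 3 / (6 * b%:R) * l = \sum_(i < b) (Num.sqrt 3 / 6 * l * b%:R^-1 ^+ 2).
  rewrite sumr_const card_ord -[RHS]mulr_natr; field; rewrite gt_eqF//.
rewrite -big_split/= -sumEFin; apply: lee_sum => i _.
rewrite ge0_integralD// EFinD; apply: leeD.
  rewrite integral_indicM//.
  have := lipschitz_mean_deviation (bin_lt i) lip_q.
  rewrite bin_width -[\int[mu]_(y in _) q y]/(bin_mass i) invrK (mulrC (bin_mass i)).
  rewrite -lee_fin; apply: le_trans; rewrite /Rintegral fineK//.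
  apply: integrable_fin_num; first exact: measurable_bin.
  apply: (@continuous_integrable_co _ _ _ (fun x => `|q x - b%:R * bin_mass i|)) => x.
  apply: cvg_norm; apply: cvgB; last exact: cvg_cst.
  exact: (lipschitz_continuous lip_q).
under eq_integral do rewrite EFinM.
rewrite ge0_integralZl//; last exact/measurable_EFinP.
rewrite integral_indic//; last exact: measurable_bin.
by rewrite setIT [X in (_ * X)%E]lebesgue_measure_bin -EFinM mulfK ?gt_eqF.
Qed.

End approximation.
End histogram.

(** * Multi-view histograms *)

Section mixtures.
Context d (T : measurableType d) (R : realType) (mu : {measure set T -> \bar R}).
Local Open Scope ereal_scope.

(** Spectra are indexed from 1 and tails start later, whereas series are integrated term by term
    from index 0. *)
Lemma nneseries_shift (u : (\bar R)^nat) N : (forall i, (N <= i)%N -> 0 <= u i) ->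
  \sum_(N <= i <oo) u i = \sum_(i <oo) u (i + N)%N.
Proof.
move=> u0; have /cvg_ex[/= l ul] : cvgn (fun n => \sum_(N <= i < n) u i).
  by apply: is_cvg_nneseries => i Ni _; exact: u0.
rewrite (cvg_lim _ ul)//; apply/esym/cvg_lim => //=.
move: ul; rewrite -(cvg_shiftn N) /=.
by under eq_fun do rewrite -{1}(add0n N)// big_addn addnK.
Qed.

Lemma is_pdf_mixture k (w : 'I_k -> R) (h : 'I_k -> T -> R) :
  (forall i, (0 <= w i)%R) -> (\sum_i w i)%R = 1%R ->
  (forall i, is_pdf mu (h i)) -> (forall i x, (0 <= h i x)%R) ->
  is_pdf mu (fun x => (\sum_(i < k) w i * h i x)%R).
Proof.
move=> w0 w1 ph h0.
have mh i : measurable_fun setT (h i) := pdf_measurable (ph i).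
split.
- by apply: measurable_sum => i; exact: measurable_funM.
- by apply: aeW => x; apply: sumr_ge0 => i _; rewrite mulr_ge0.
under eq_integral do rewrite -sumEFin.
rewrite ge0_integral_sum//; last 2 first.
- by move=> i; apply/measurable_EFinP; exact: measurable_funM.
- by move=> i x _; rewrite lee_fin mulr_ge0.
transitivity ((\sum_i w i)%:E); last by rewrite w1.
rewrite -sumEFin; apply: eq_bigr => i _.
under eq_integral do rewrite EFinM.
rewrite ge0_integralZl//; last 3 first.
- exact/measurable_EFinP.
- by move=> x _; rewrite lee_fin.
- by rewrite lee_fin.
by case: (ph i) => _ _ ->; rewrite mule1.
Qed.

(** Each kept term changes by [(v - w) h + v (r - h)]: the weight changes on the new component, the
    component changes under the old weight. The rest of the series has as its integral the sum of
    its weights. *)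
Lemma L1_mixture_le (p : T -> R) (v : nat -> R) (r : nat -> T -> R)
    k (w : 'I_k -> R) (h : 'I_k -> T -> R) :
  measurable_fun setT p -> (forall i, (0 <= v i)%R) ->
  (forall i, is_pdf mu (r i)) -> (forall i x, (0 <= r i x)%R) ->
  (forall i, is_pdf mu (h i)) -> (forall i x, (0 <= h i x)%R) ->
  {ae mu, forall x, (p x)%:E = \sum_(i <oo) (v i * r i x)%:E} ->
  \int[mu]_x `|p x - \sum_(i < k) w i * h i x|%:E <=
  \sum_(i < k) (`|v i - w i|%:E + (v i)%:E * \int[mu]_x `|r i x - h i x|%:E)
  + \sum_(k <= i <oo) (v i)%:E.
Proof.
move=> mp v0 pr r0 ph h0 pE.
have mr i : measurable_fun setT (r i) := pdf_measurable (pr i).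
have mh i : measurable_fun setT (h i) := pdf_measurable (ph i).
pose tail (x : T) : \bar R := \sum_(i <oo) (v (i + k)%N * r (i + k)%N x)%:E.
have term0 i x : 0 <= (v i * r i x)%:E by rewrite lee_fin mulr_ge0.
have mterm i : measurable_fun setT (fun x => (v i * r i x)%:E).
  by apply/measurable_EFinP; exact: measurable_funM.
have tail0 x : 0 <= tail x by apply: nneseries_ge0.
have mtail : measurable_fun setT tail.
  by apply: ge0_emeasurable_sum => //.
have int_tail : \int[mu]_x tail x = \sum_(k <= i <oo) (v i)%:E.
  rewrite integral_nneseries// [RHS]nneseries_shift; last first.
    by move=> i _; rewrite lee_fin.
  apply: eq_eseriesr => i _; under eq_integral do rewrite EFinM.
  rewrite ge0_integralZl//; last 3 first.
  - exact/measurable_EFinP.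
  - by move=> x _; rewrite lee_fin.
  - by rewrite lee_fin.
  by case: (pr (i + k)%N) => _ _ ->; rewrite mule1.
pose g (i : 'I_k) x : \bar R :=
  `|v i - w i|%:E * (h i x)%:E + (v i)%:E * `|r i x - h i x|%:E.
have mdist i : measurable_fun setT (fun x => `|r (nat_of_ord i) x - h i x|%:E).
  by apply/measurable_EFinP; apply: measurableT_comp => //; exact: measurable_funB.
have mhE i : measurable_fun setT (fun x => (h i x)%:E) by exact/measurable_EFinP.
have g0 i x : 0 <= g i x by rewrite adde_ge0// mule_ge0// lee_fin.
have mg i : measurable_fun setT (g i).
  by apply: emeasurable_funD; apply: emeasurable_funM.
rewrite -int_tail.
apply: (@le_trans _ _ (\int[mu]_x (\sum_(i < k) g i x + tail x))).
  apply: ae_ge0_le_integral => //.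
  - apply/measurable_EFinP; apply: measurableT_comp => //.
    by apply: measurable_funB => //; apply: measurable_sum => i; exact: measurable_funM.
  - by move=> x _; rewrite adde_ge0// sume_ge0.
  - by apply: emeasurable_funD => //; exact: emeasurable_sum.
  apply: filterS pE => x pxE _.
  have : (p x)%:E = (\sum_(i < k) v i * r i x)%:E + tail x.
    rewrite pxE (nneseries_split 0 k)// add0n big_mkord sumEFin.
    by rewrite [X in _ + X]nneseries_shift.
  (* The tail is finite at every point where the series equals the real number [p x]. *)
  have := tail0 x; case: (tail x) => [t|//|//]; rewrite lee_fin -EFinD => t0 [px].
  rewrite /g; under [X in _ <= X + _]eq_bigr do rewrite -!EFinM -EFinD.
  rewrite sumEFin -EFinD lee_fin.
  have -> : (p x - \sum_(i < k) w i * h i x =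
      \sum_(i < k) ((v i - w i) * h i x + v i * (r i x - h i x)) + t)%R.
    rewrite px -addrAC; congr (_ + _)%R; rewrite -sumrB.
    by apply: eq_bigr => i _; ring.
  apply: (le_trans (ler_normD _ _)); rewrite (ger0_norm t0) lerD2r.
  apply: (le_trans (ler_norm_sum _ _ _)); apply: ler_sum => i _.
  apply: (le_trans (ler_normD _ _)).
  by rewrite !normrM (ger0_norm (h0 _ _)) (ger0_norm (v0 _)).
rewrite ge0_integralD//; last 2 first.
- by move=> x _; apply: sume_ge0.
- exact: emeasurable_sum.
rewrite leeD2r// ge0_integral_sum//; apply: lee_sum => i _.
rewrite ge0_integralD//; last 4 first.
- by move=> x _; rewrite mule_ge0// lee_fin.
- exact: emeasurable_funM.
- by move=> x _; rewrite mule_ge0// lee_fin.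
- exact: emeasurable_funM.
rewrite ge0_integralZl//; last by move=> x _; rewrite lee_fin.
rewrite ge0_integralZl// ?lee_fin//.
by case: (ph i) => _ _ ->; rewrite mule1.
Qed.

End mixtures.

(** * Product densities, and what the support of a mixture imposes on their factors *)

Section product_densities.
Context (R : realType) (d : nat).
Local Notation mu := (@lebesgue_measure R).
Local Notation RT := (measurableTypeR R).
Implicit Types (f : 'I_d -> RT -> R).

Lemma is_pdf_prod_tnth f : (forall j, is_pdf mu (f j)) ->
  (forall j x, 0 <= f j x) ->
  is_pdf (lebesgue_tuple d) (fun x => \prod_(j < d) f j (tnth x j)).
Proof.
move=> pf f0; have mf j := pdf_measurable (pf j); split.
- exact: measurable_prod_tnth.
- by apply: aeW => x; apply: prodr_ge0.
by rewrite integral_prod_tnth// big1// => j _; case: (pf j).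
Qed.

(** A negative value would force negative values on an interval of positive length, against
    non-negativity almost everywhere. *)
Lemma lipschitz_pdf_ge0 (q : RT -> R) (l : R) : is_pdf mu q ->
  (forall x y, `|q x - q y| <= l * `|x - y|) -> forall x, 0 <= q x.
Proof.
move=> [mq q0 _] lip x; rewrite leNgt; apply/negP => qx0.
have l0 := lipschitz_const_ge0 lip.
(* The denominator [l + 1] is positive even if [l = 0], and [l * e = - q x - e] stays below
   [- q x]. *)
pose e := - q x / (l + 1).
have e0 : 0 < e by rewrite divr_gt0 ?oppr_gt0// ltr_wpDl.
have neg y : x <= y < x + e -> q y < 0.
  move=> /andP[xy ye]; have := lip y x; rewrite [`|y - x|]ger0_norm ?subr_ge0// => h.
  have h1 : l * (y - x) <= l * e by rewrite ler_wpM2l//; lra.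
  have h2 : e * (l + 1) = - q x by rewrite /e divfK// gt_eqF// ltr_wpDl.
  by have := le_trans (ler_norm _) (le_trans h h1); lra.
have : mu.-negligible (`[x, x + e[%classic : set RT).
  apply: negligibleS q0 => y; rewrite /= in_itv/= => /neg qy0.
  by rewrite leNgt qy0.
move=> /negligibleP => /(_ (measurable_itv _)) mu0.
have muI : mu (`[x, x + e[%classic : set RT) = e%:E.
  apply: (etrans (lebesgue_measure_itv `[x, x + e[)).
  by rewrite /= lte_fin ltrDl e0 -EFinD; congr EFin; ring.
by move: (etrans (esym muI) mu0) => [] /eqP; rewrite gt_eqF.
Qed.

(* Where [p] vanishes so does [v * prod f], hence the product density gives mass
   one to the cube and each factor gives mass one to the unit interval. *)
Lemma support_factor (p : Rvec R d -> R) f (v : R) : 0 < v ->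
  (forall j, is_pdf mu (f j)) -> (forall j x, 0 <= f j x) ->
  {ae lebesgue_tuple d, forall x, ~ unit_cube d x -> p x = 0} ->
  {ae lebesgue_tuple d, forall x, v * \prod_(j < d) f j (tnth x j) <= p x} ->
  forall j, (\int[mu]_(x in `[0%R, 1%R]) (f j x)%:E = 1)%E.
Proof.
move=> v0 pf f0 p_out p_ge j.
have mf i := pdf_measurable (pf i).
pose I : set RT := `[0, 1]%classic.
pose g i : RT -> R := fun x => f i x * \1_I x.
have g0 i x : 0 <= g i x by rewrite mulr_ge0.
have mg i : measurable_fun setT (g i).
  by apply: measurable_funM => //; apply: measurable_indic; exact: measurable_itv.
have gE i : (\int[mu]_x (g i x)%:E = \int[mu]_(x in `[0%R, 1%R]) (f i x)%:E)%E.
  rewrite [RHS]integral_mkcond; apply: eq_integral => x _.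
  by rewrite patchE /g indicE /I; case: (x \in _); rewrite ?mulr1 ?mulr0.
have g_le1 i : (\int[mu]_x (g i x)%:E <= 1)%E.
  have [_ _ <-] := pf i; apply: ge0_le_integral => //.
  - by move=> x _; rewrite lee_fin.
  - exact/measurable_EFinP.
  - exact/measurable_EFinP.
  - by move=> x _; rewrite lee_fin ler_piMr// indicE; case: (_ \in _).
have prod1 : (\prod_(i < d) \int[mu]_x (g i x)%:E = 1)%E.
  rewrite -integral_prod_tnth//.
  have [_ _ <-] := is_pdf_prod_tnth pf f0.
  apply: ge0_ae_eq_integral => //.
  - by apply/measurable_EFinP; exact: measurable_prod_tnth.
  - by apply/measurable_EFinP; exact: measurable_prod_tnth.
  - by move=> x _; rewrite lee_fin prodr_ge0.
  - by move=> x _; rewrite lee_fin prodr_ge0.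
  apply: filterS2 p_out p_ge => x out ge _; congr EFin.
  have [cx|ncx] := pselect (unit_cube d x).
    apply: eq_bigr => i _; rewrite /g indicE mem_set ?mulr1//= /I /= in_itv/=.
    exact: cx.
  have : v * \prod_(i < d) f i (tnth x i) <= 0 by rewrite -(out ncx).
  rewrite pmulr_rle0// => prod0.
  have {prod0} prod0 : \prod_(i < d) f i (tnth x i) = 0.
    by apply/eqP; rewrite eq_le prod0 prodr_ge0.
  by rewrite /g big_split/= prod0 mul0r.
have fin i : (\int[mu]_x (g i x)%:E)%E \is a fin_num.
  rewrite ge0_fin_numE; first exact: le_lt_trans (g_le1 i) (ltry _).
  by apply: integral_ge0 => x _; rewrite lee_fin.
(* All masses are at most one and their product is one, so the [j]-th is at least the product, hence
   at least one. *)
rewrite -gE; apply/eqP; rewrite eq_le g_le1/= -prod1 (bigD1 j)//=.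
rewrite -[leRHS]mule1; apply: lee_pmul => //.
- by apply: integral_ge0 => x _; rewrite lee_fin.
- apply: prode_ge0 => i _; apply: integral_ge0 => x _; by rewrite lee_fin.
rewrite -(eq_bigr _ (fun i _ => fineK (fin i))) prodEFin lee_fin.
apply: prodr_ile1 => i _; rewrite fine_ge0/=; last first.
  by apply: integral_ge0 => x _; rewrite lee_fin.
by rewrite -lee_fin fineK.
Qed.

End product_densities.

(** * The finite net and its approximation of NL-classes *)

Section multiview_histograms.
(* [k.+1] components and [b.+1] bins; the weights have denominator [M]. *)
Context (R : realType) (d k b M : nat).
Local Notation mu := (@lebesgue_measure R).
Local Notation RT := (measurableTypeR R).

(** Codes for the mixture weights and for the bin masses of every factor of every component; each
    code omits the first coordinate of its simplex point. *)
Definition net : finType :=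
  ({ffun 'I_k -> 'I_M.+1} *
   {ffun 'I_k.+1 * 'I_d -> {ffun 'I_b -> 'I_M.+1}})%type.

(** The exponent is [k + b * d * k.+1]: the coordinates omitted from the histograms make room for
    the [k] mixture weights. *)
Lemma card_net : (0 < d)%N -> (#|net| <= M.+1 ^ (b.+1 * d * k.+1))%N.
Proof.
move=> d0; rewrite card_prod !card_ffun card_prod !card_ord -expnM -expnD.
by apply: leq_pexp2l => //; nia.
Qed.

Implicit Types (th : net).

Definition marginal_hist th (i : 'I_k.+1) (j : 'I_d) : RT -> R :=
  hist (grid_weight R (th.2 (i, j))).

Definition multiview_hist th (x : Rvec R d) : R :=
  \sum_(i < k.+1) grid_weight R th.1 i * \prod_(j < d) marginal_hist th i j (tnth x j).

Lemma marginal_hist_ge0 th i j x : 0 <= marginal_hist th i j x.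
Proof. by apply: hist_ge0 => // m; exact: grid_weight_ge0. Qed.

Lemma is_pdf_marginal_hist th i j : is_pdf mu (marginal_hist th i j).
Proof.
by apply: is_pdf_hist => //; [move=> m; exact: grid_weight_ge0|exact: sum_grid_weight].
Qed.

Lemma cube_pdf_multiview_hist th : cube_pdf d (multiview_hist th).
Proof.
split.
  apply: is_pdf_mixture.
  - by move=> i; exact: grid_weight_ge0.
  - exact: sum_grid_weight.
  - move=> i; apply: is_pdf_prod_tnth => j; first exact: is_pdf_marginal_hist.
    exact: marginal_hist_ge0.
  - by move=> i x; apply: prodr_ge0 => j _; exact: marginal_hist_ge0.
apply: aeW => x /existsNP[j xj]; apply: big1 => i _.
by rewrite (bigD1 j)//= [marginal_hist _ _ _ _]hist_eq0// mul0r mulr0.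
Qed.

(** The bin masses of [q] are rounded; as they sum to one, only the rounding error [2 b / M] is
    added. *)
Lemma marginal_approx (q : RT -> R) (l : R) : (0 < M)%N ->
  is_pdf mu q -> (forall x y, `|q x - q y| <= l * `|x - y|) ->
  (\int[mu]_(x in `[0%R, 1%R]) (q x)%:E = 1)%E ->
  exists u : {ffun 'I_b -> 'I_M.+1},
    (\int[mu]_x `|q x - hist (grid_weight R u) x|%:E <=
     (Num.sqrt 3 / (6 * b.+1%:R) * l + 2 * b%:R / M%:R)%:E)%E.
Proof.
move=> M0 pq lip supp; have q0 := lipschitz_pdf_ge0 pq lip.
have b0 : (0 < b.+1)%N by [].
have m1 : \sum_i bin_mass (b := b.+1) q i = 1 by exact: sum_bin_mass.
have [|u hu] := grid_weight_approx M0 (a := bin_mass (b := b.+1) q) (bin_mass_ge0 q0).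
  by rewrite m1.
exists u; apply: (le_trans (L1_hist_le b0 pq q0 lip supp _)).
by rewrite lee_fin lerD2l; rewrite m1 subrr add0r in hu.
Qed.

(** The dropped tail and the completion of the kept weights cost at most [W k.+1] each. The errors
    of the components are averaged with weights of sum at most one, so they are multiplied by [d]
    but not by the number of components. *)
Theorem NL_class_approx (p : Rvec R d -> R) (W L : nat -> R) : (0 < M)%N ->
  NL_params W L -> cube_pdf d p -> NL_class d W L p ->
  exists th, (\int[lebesgue_tuple d]_x `|p x - multiview_hist th x|%:E <=
    (2 * W k.+1 + 2 * k%:R / M%:R +
     d%:R * (Num.sqrt 3 / (6 * b.+1%:R) * L k.+1 + 2 * b%:R / M%:R))%:E)%E.
Proof.
move=> M0 [W0 _ _ L0 Lmono] [pp p_out] [_ [w [l [[q [w0 w1 _ qP pE]] wl]]]].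
pose v i := w i.+1.
have v0 i : 0 <= v i by exact: w0.
pose f i := q i.+1; pose r i (x : Rvec R d) := \prod_(j < d) f i j (tnth x j).
have pf i j : is_pdf mu (f i j) by have [] := qP i.+1 j isT.
have lip i j x y : `|f i j x - f i j y| <= l i.+1 * `|x - y|.
  by have [_ /(_ (x, y))] := qP i.+1 j isT; apply.
have f0 i j x : 0 <= f i j x by exact: (lipschitz_pdf_ge0 (pf i j) (lip i j)).
have pr i : is_pdf (lebesgue_tuple d) (r i) by exact: is_pdf_prod_tnth.
have r0 i x : 0 <= r i x by exact: prodr_ge0.
have term0 i x : (0 <= (v i * r i x)%:E)%E by rewrite lee_fin mulr_ge0.
have pvE : {ae lebesgue_tuple d, forall x,
    (p x)%:E = (\sum_(i <oo) (v i * r i x)%:E)%E}.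
  apply: filterS pE => x ->; rewrite nneseries_shift.
    by apply: eq_eseriesr => i _; rewrite addn1.
  by case=> // i _; exact: term0.
have v1 : (\sum_(i <oo) (v i)%:E = 1)%E.
  rewrite -w1 [RHS]nneseries_shift; last by move=> i i1; rewrite lee_fin w0.
  by apply: eq_eseriesr => i _; rewrite addn1.
have vE0 i : (0 <= (v i)%:E)%E by rewrite lee_fin.
(* The tail of [v] from [k.+1] is the tail of [w] from [k.+2], which is the one bounded by
   [W k.+1]. *)
have tailW : (\sum_(k.+1 <= i <oo) (v i)%:E <= (W k.+1)%:E)%E.
  have [_] := wl k.+1 isT; apply: le_trans.
  rewrite nneseries_shift; last by move=> i _; rewrite lee_fin.
  rewrite [leRHS]nneseries_shift; last by move=> i ik; rewrite lee_fin w0// (leq_trans _ ik).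
  rewrite (@eq_eseriesr _ _ (fun i => (w (i + k.+2)%N)%:E))// => i _.
  by rewrite /v -addnS.
have headW : 1 - W k.+1 <= \sum_(i < k.+1) v i <= 1.
  have : ((\sum_(i < k.+1) v i)%:E + \sum_(k.+1 <= i <oo) (v i)%:E = 1)%E.
    by rewrite -[RHS]v1 (nneseries_split 0 k.+1)// add0n big_mkord sumEFin.
  have : (0 <= \sum_(k.+1 <= i <oo) (v i)%:E)%E.
    by apply: nneseries_ge0 => i _ _; rewrite lee_fin.
  move: tailW; case: (\big[_/_]_(_ <= i <oo) _) => [t|//|//].
  by rewrite !lee_fin -EFinD => tW t0 [] h; apply/andP; split; lra.
pose E := Num.sqrt 3 / (6 * b.+1%:R) * L k.+1 + 2 * b%:R / M%:R.
have E0 : 0 <= E.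
  by rewrite addr_ge0// ?divr_ge0 ?mulr_ge0 ?divr_ge0 ?sqrtr_ge0 ?invr_ge0 ?L0.
(* Only a component of positive weight is known to live on the cube. One of weight zero may lie
   anywhere and gets an arbitrary code, since its error is multiplied by zero. *)
have /choice[u uP] : forall ij : 'I_k.+1 * 'I_d, exists u : {ffun 'I_b -> 'I_M.+1},
    0 < v ij.1 ->
    (\int[mu]_x `|f ij.1 ij.2 x - hist (grid_weight R u) x|%:E <= E%:E)%E.
  move=> [i j] /=; have [vi0|_] := ltP 0 (v i); last by exists [ffun=> ord0].
  have supp : (\int[mu]_(x in `[0%R, 1%R]) (f i j x)%:E = 1)%E.
    apply: (support_factor vi0 (pf i) (f0 i) p_out).
    (* A series of non-negative terms dominates each of its terms. *)
    apply: filterS pvE => x px; rewrite -lee_fin px.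
    rewrite (nneseries_split 0 i.+1)// add0n big_nat_recr//=.
    rewrite -[leLHS]add0e -[leLHS]adde0; apply: leeD; last exact: nneseries_ge0.
    by apply: leeD => //; exact: sume_ge0.
  have [u hu] := marginal_approx M0 (pf i j) (lip i j) supp.
  exists u => _; apply: (le_trans hu); rewrite lee_fin lerD2r ler_wpM2l//.
  (* The kept components have index at most [k.+1], so [L k.+1] bounds all their Lipschitz
     constants. *)
  have [lL _] := wl i.+1 isT; apply: (le_trans lL); apply: Lmono.
  by rewrite /= ltn_ord.
have [|y yP] := grid_weight_approx M0 (a := fun i : 'I_k.+1 => v i) (fun i => v0 i).
  by case/andP: headW.
pose th : net := (y, [ffun ij => u ij]).
exists th.
have mp : measurable_fun setT p := pdf_measurable pp.
have ph i : is_pdf (lebesgue_tuple d)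
    (fun x => \prod_(j < d) marginal_hist th i j (tnth x j)).
  apply: is_pdf_prod_tnth => j; first exact: is_pdf_marginal_hist.
  exact: marginal_hist_ge0.
have h0 i x : 0 <= \prod_(j < d) marginal_hist th i j (tnth x j).
  by apply: prodr_ge0 => j _; exact: marginal_hist_ge0.
apply: (le_trans (L1_mixture_le (grid_weight R y) mp v0 pr r0 ph h0 pvE)).
apply: (@le_trans _ _ (\sum_(i < k.+1) (`|v i - grid_weight R y i| +
    v i * (d%:R * E))%:E + (W k.+1)%:E)%E).
  apply: leeD => //; apply: lee_sum => i _; rewrite EFinD leeD2l//.
  have [vi0|] := ltP 0 (v i); last first.
    rewrite le_eqVlt ltNge v0 orbF => /eqP ->.
    by rewrite mul0e mul0r.
  rewrite EFinM lee_pmul2l ?lte_fin// ?fin_numE//.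
  apply: (le_trans (L1_prod_tnth_le (pf i) (is_pdf_marginal_hist th i) (f0 i)
    (marginal_hist_ge0 th i))).
  rewrite (_ : d%:R * E = \sum_(j < d) E); last first.
    by rewrite sumr_const card_ord mulr_natl.
  rewrite -sumEFin; apply: lee_sum => j _.
  by rewrite /marginal_hist ffunE; exact: (uP (i, j)).
rewrite sumEFin -EFinD lee_fin big_split/= -mulr_suml.
have /andP[hW1 hW2] := headW.
have dE0 : 0 <= d%:R * E by rewrite mulr_ge0.
have := ler_wpM2r dE0 hW2; rewrite mul1r -/E => h1; lra.
Qed.

End multiview_histograms.

(** * The estimator *)

Lemma union_bound d (T : measurableType d) (R : realType) (P : probability T R)
    (I : finType) (F : I -> set T) (E : set T) (c : R) :
  measurable E -> (forall i, measurable (F i)) -> E `<=` \bigcup_i F i ->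
  (forall i, (P (F i) <= c%:E)%E) -> (P E <= (#|I|%:R * c)%:E)%E.
Proof.
move=> mE mF EF Pc.
have bound (s : seq I) : measurable (\big[setU/set0]_(i <- s) F i) /\
    (P (\big[setU/set0]_(i <- s) F i) <= ((size s)%:R * c)%:E)%E.
  elim: s => [|i s [ms IH]]; first by rewrite big_nil measure0 mul0r.
  rewrite big_cons; split; first exact: measurableU.
  apply: (le_trans (measureU2 _ _ _)) => //.
  by rewrite /= -natr1 mulrDl mul1r addrC EFinD leeD.
have [mU PU] := bound (enum I).
rewrite cardE; apply: le_trans PU; apply: le_measure; rewrite ?inE//.
apply: (subset_trans EF) => x [i _ Fx]; rewrite -bigcup_seq.
by exists i => //=; rewrite mem_enum.
Qed.

Lemma L1_distE (R : realType) d (f g : Rvec R d -> R) : cube_pdf d f -> cube_pdf d g ->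
  L1_dist f g = (\int[lebesgue_tuple d]_x `|f x - g x|)%:E.
Proof.
move=> [pf _] [pg _]; rewrite /L1_dist Lnorm1 /Rintegral fineK//.
by apply: integrable_fin_num => //; exact: integrable_normr_pdfB.
Qed.

(** From [exp (- 1 / 2) >= 1 - 1 / 2] and squaring, [e <= 4]. *)
Lemma ln4_ge1 (R : realType) : 1 <= ln 4 :> R.
Proof.
have h := expR_ge1Dx (- (1 / 2) : R).
have e : expR (- 1) = expR (- (1 / 2) : R) ^+ 2.
  by rewrite -expRM_natl; congr expR; field.
rewrite -ler_expR lnK ?posrE// -[leLHS]invrK -expRN e.
rewrite -[leRHS]invrK lef_pV2 ?posrE ?invr_gt0 ?exprn_gt0 ?expR_gt0//.
by have := expR_gt0 (- (1 / 2) : R); nra.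
Qed.

(** * Numerical constants: resolution of the net and failure probability *)

Section constants.
Context (R : realType) (d b k n : nat).
Hypotheses (d0 : (0 < d)%N) (n0 : (0 < n)%N).
Let K := (4 * b.+1 * d * k.+1 * n)%N.
Let a : R := Num.sqrt (2 * b.+1%:R * d%:R * k.+1%:R * ln K%:R / n%:R).

Let lnK_ge1 : 1 <= ln K%:R :> R.
Proof.
apply: (le_trans (ln4_ge1 R)); rewrite ler_ln ?posrE ?ltr0n ?ler_nat /K; lia.
Qed.

Let radicand_ge0 : 0 <= 2 * b.+1%:R * d%:R * k.+1%:R * ln K%:R / n%:R :> R.
Proof. by rewrite divr_ge0 ?mulr_ge0//; apply: le_trans lnK_ge1. Qed.

(** The left side is three times the rounding error for the denominator [K.-1]. It is at most
    [4 / n], while [a^2 >= 2 / n] because the logarithm is at least one. Of the final [7 a],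
    rounding thus takes [3 a] and leaves [4 a] for the deviations. *)
Lemma net_error_le :
  6 * (k%:R + d%:R * b%:R) / K.-1%:R <= 3 * a :> R.
Proof.
have n0R : 0 < n%:R :> R by rewrite ltr0n.
have K1 : (3 * (b.+1 * d * k.+1 * n) <= K.-1)%N by rewrite /K; nia.
have K0 : 0 < K.-1%:R :> R by rewrite ltr0n; move: K1; nia.
apply: (@le_trans _ _ (4 / n%:R)).
  rewrite ler_pdivrMr// mulrAC ler_pdivlMr//.
  have : (6 * (k + d * b) * n <= 4 * K.-1)%N by move: K1; nia.
  by rewrite -(ler_nat R) !natrM natrD natrM.
rewrite -ler_pdivrMl// -(ler_pXn2r (n := 2))// ?nnegrE ?sqrtr_ge0//.
rewrite sqr_sqrtr//.
have B1 : 1 <= b.+1%:R * d%:R * k.+1%:R :> R by rewrite -!natrM ler1n; nia.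
have n1 : 1 <= n%:R :> R by rewrite ler1n.
have in1 : n%:R^-1 <= 1 :> R by rewrite invf_le1.
have in0 : 0 < n%:R^-1 :> R by rewrite invr_gt0.
apply: (@le_trans _ _ (2 * n%:R^-1)).
  have -> : (3^-1 * (4 / n%:R)) ^+ 2 = 16 / 9 * (n%:R^-1 * n%:R^-1) :> R.
    by field; rewrite gt_eqF.
  have : n%:R^-1 * n%:R^-1 <= n%:R^-1 :> R by rewrite ler_piMr// ltW.
  lra.
rewrite ler_pM2r//.
have := ler_pM (ler01 : 0 <= 1 :> R) ler01 B1 lnK_ge1; rewrite mulr1.
lra.
Qed.

(** The factor [exp (- n a^2)] is [K^(- 2 m)] and cancels the number of pairs; the confidence term
    leaves at most [2 * delta / 3]. *)
Lemma failure_probability_lt (N : nat) (delta : R) :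
  (N <= K ^ (b.+1 * d * k.+1))%N -> 0 < delta <= 1 ->
  (N * N)%:R * (2 * expR (- (n%:R *
    (a + 7 / 4 * Num.sqrt (ln (3 / delta) / (2 * n%:R))) ^+ 2))) < delta.
Proof.
move=> NK /andP[delta0 delta1].
have n0R : 0 < n%:R :> R by rewrite ltr0n.
have K0 : 0 < K%:R :> R by rewrite ltr0n /K; nia.
have d3 : 1 <= 3 / delta by rewrite ler_pdivlMr//; lra.
have ln3 : 0 <= ln (3 / delta) by exact: ln_ge0.
set c := Num.sqrt _.
have c2 : n%:R * c ^+ 2 = ln (3 / delta) / 2.
  rewrite sqr_sqrtr ?divr_ge0 ?mulr_ge0//.
  by field; rewrite gt_eqF.
have a2 : n%:R * a ^+ 2 = 2 * b.+1%:R * d%:R * k.+1%:R * ln K%:R.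
  by rewrite sqr_sqrtr// mulrC divfK// gt_eqF.
have a0 : 0 <= a by exact: sqrtr_ge0.
have c0 : 0 <= c by exact: sqrtr_ge0.
pose m := (b.+1 * d * k.+1)%N.
(* The cross term is non-negative, and [(7 / 4)^2 / 2 = 49 / 32] exceeds 1. *)
have expo : (m + m)%:R * ln K%:R + ln (3 / delta) <= n%:R * (a + 7 / 4 * c) ^+ 2.
  have -> : n%:R * (a + 7 / 4 * c) ^+ 2 =
    n%:R * a ^+ 2 + 49 / 16 * (n%:R * c ^+ 2) + 7 / 2 * (n%:R * (a * c)) by field.
  rewrite a2 c2 natrD !natrM.
  have : 0 <= n%:R * (a * c) by rewrite !mulr_ge0.
  lra.
have NN : (N * N)%:R <= K%:R ^+ (m + m) :> R.
  by rewrite exprD natrM -natrX ler_pM ?ler_nat.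
apply: (@le_lt_trans _ _ (K%:R ^+ (m + m) *
    (2 * expR (- ((m + m)%:R * ln K%:R + ln (3 / delta)))))).
  apply: ler_pM => //.
  by rewrite ler_pM2l// ler_expR lerN2.
rewrite opprD expRD !expRN expRM_natl !lnK ?posrE ?divr_gt0// invf_div.
rewrite mulrCA mulVKf ?gt_eqF ?exprn_gt0//; lra.
Qed.

End constants.

Theorem theorem5 (R : realType) (d b k n : nat) (delta : R)
    (hd : (1 <= d)%N) (hb : (1 <= b)%N) (hk : (1 <= k)%N) (hn : (1 <= n)%N)
    (hdelta0 : 0 < delta) (hdelta1 : delta <= 1) :
  exists V : n.-tuple (Rvec R d) -> Rvec R d -> R,
    is_estimator V /\
    forall W L : nat -> R, NL_params W L ->
    forall p : Rvec R d -> R, cube_pdf d p -> NL_class d W L p ->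
    forall (disp : measure_display) (Omega : measurableType disp)
      (P : probability Omega R) (X : 'I_n -> {RV P >-> Rvec R d}),
      (forall i, has_density (X i) p) -> independent_RVs X ->
      (P [set om |
          (Num.sqrt 3 * d%:R / (2 * b%:R) * L k + 6 * W k
           + 7 * Num.sqrt
               (2 * b%:R * d%:R * k%:R * ln (4 * b%:R * d%:R * k%:R * n%:R)
                / n%:R)
           + 7 * Num.sqrt (ln (3 / delta) / (2 * n%:R)))%:E
          < L1_dist p (V [tuple X i om | i < n])]
       < delta%:E)%E.
Proof.
case: b hb => [//|b] _; case: k hk => [//|k] _.
pose K := (4 * b.+1 * d * k.+1 * n)%N; pose M := K.-1.
have KM : K = M.+1 by rewrite /M prednK// /K; nia.
have M0 : (0 < M)%N by rewrite /M /K; nia.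
pose th0 : net d k b M := ([ffun=> ord0], [ffun=> [ffun=> ord0]]).
pose f (th : net d k b M) : Rvec R d -> R := multiview_hist (R := R) th.
have cf th : cube_pdf d (f th) by exact: cube_pdf_multiview_hist.
have pf th : is_pdf (lebesgue_tuple d) (f th) by case: (cf th).
pose sel := @yatracos _ _ _ (lebesgue_tuple d) _ th0 f n.
have msel th : measurable [set s | sel s = th] by exact: measurable_yatracos.
exists (fun s => f (sel s)); split.
  split=> [s|B _]; first exact: cf.
  (* The estimator takes finitely many values, so a preimage is a finite union of level sets of
     [sel]. *)
  rewrite (_ : _ @^-1` B = \bigcup_(th in [set th | B (f th)]) [set s | sel s = th]).
    by apply: fin_bigcup_measurable.
  by apply/seteqP; split=> s /= => [Bs|[th Bth ->]//]; exists (sel s).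
move=> W L WL p cp NLp disp Omega P X densX indepX.
have pp : is_pdf (lebesgue_tuple d) p by case: cp.
have [th thP] := NL_class_approx k b M0 WL cp NLp.
set c := Num.sqrt (ln (3 / delta) / _).
have -> : 4 * b.+1%:R * d%:R * k.+1%:R * n%:R = K%:R :> R by rewrite !natrM.
set a := Num.sqrt (_ * ln _ / _).
(* Chosen so that [4 t = 4 a + 7 c], with [4 t] the stochastic term of the selection bound. *)
pose t := a + 7 / 4 * c.
have t0 : 0 <= t by rewrite addr_ge0 ?mulr_ge0 ?divr_ge0 ?sqrtr_ge0.
pose A := scheffe_set f.
have mA i j : measurable (A i j) by exact: (measurable_scheffe_set pf).
pose obs om : n.-tuple (Rvec R d) := [tuple X i om | i < n].
have mobs : measurable_fun setT obs.
  apply/measurable_fun_tnthP => i; rewrite (_ : _ \o _ = X i)//.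
  by apply/funext => om /=; rewrite tnth_mktuple.
pose prA (z : net d k b M * net d k b M) : R :=
  \int[lebesgue_tuple d]_(x in A z.1 z.2) p x.
have PA z i : P (X i @^-1` A z.1 z.2) = (prA z)%:E.
  have := densX i _ (mA z.1 z.2); rewrite /distribution /pushforward => ->.
  rewrite /prA /Rintegral fineK//; apply: integrable_fin_num => //.
  by apply: integrableS (pdf_integrable pp).
have hoeff z := hoeffding_indic indepX hn (mA z.1 z.2) (PA z) t0.
have empE z om : empirical R (A z.1 z.2) (obs om) =
    (\sum_(i < n) \1_(A z.1 z.2) (X i om)) / n%:R.
  by congr (_ / _); apply: eq_bigr => i _; rewrite tnth_mktuple.
set thr := (_ + _ + _ + _)%R.
set E := [set om | _].
have mE : measurable E.
  rewrite (_ : E = \bigcup_(j in [set j | (thr%:E < L1_dist p (f j))%E])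
      (obs @^-1` [set s | sel s = j])).
    apply: fin_bigcup_measurable => // j _.
    by rewrite -[X in measurable X]setTI; exact: mobs.
  apply/seteqP; split=> om /= => [Eom|[j jP oj]]; first by exists (sel (obs om)).
  by rewrite /E /= -/(obs om) oj.
(* By contraposition: if no Scheffe set deviates by more than [t], the selection bound keeps the
   error below the threshold. *)
have sub : E `<=` \bigcup_z [set om |
    t < `|(\sum_(i < n) \1_(A z.1 z.2) (X i om)) / n%:R - prA z|].
  move=> om; rewrite /E /= => Eom; apply: contrapT => nz.
  have dev i j : `|empirical R (A i j) (obs om) -
      \int[lebesgue_tuple d]_(x in A i j) p x| <= t.
    rewrite leNgt; apply/negP => h; apply: nz; exists (i, j) => //=.
    by rewrite -(empE (i, j)).
  move: Eom; rewrite L1_distE// lte_fin ltNge => /negP; apply.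
  apply: (le_trans (yatracos_dist_le th0 pf th pp dev)).
  have thR : \int[lebesgue_tuple d]_x `|p x - f th x| <=
      2 * W k.+1 + 2 * k%:R / M%:R +
      d%:R * (Num.sqrt 3 / (6 * b.+1%:R) * L k.+1 + 2 * b%:R / M%:R).
    by rewrite -lee_fin -L1_distE// /L1_dist Lnorm1.
  have := net_error_le R b k hd hn; rewrite -/K -/M => ne.
  have sE : 3 * (d%:R * (Num.sqrt 3 / (6 * b.+1%:R) * L k.+1)) =
      Num.sqrt 3 * d%:R / (2 * b.+1%:R) * L k.+1 by field.
  have nE : 3 * (2 * k%:R / M%:R + d%:R * (2 * b%:R / M%:R)) =
      6 * (k%:R + d%:R * b%:R) / M%:R :> R by ring.
  rewrite -/a -nE in ne; rewrite mulrDr in thR.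
  (* Here [B] is the Lipschitz bias, [e] and [e'] are the rounding errors, [w] is [W k.+1], [x] is
     [a] and [y] is [c]. *)
  have arith (N B e e' w x y : R) : N <= 2 * w + e + (B + e') ->
      3 * (e + e') <= 3 * x ->
      3 * N + 4 * (x + 7 / 4 * y) <= 3 * B + 6 * w + 7 * x + 7 * y.
    by lra.
  by rewrite /thr -sE; exact: arith thR ne.
apply: (le_lt_trans (union_bound mE (fun z => (hoeff z).1) sub (fun z => (hoeff z).2))).
rewrite lte_fin card_prod.
apply: failure_probability_lt => //; last by rewrite hdelta0.
by rewrite -/K KM; exact: card_net.
Qed.
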